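(* Let $A=(a_1,\dots,a_n)$ be a configuration of points affinely spanning $\mathbb{R}^d$, and let $\mathcal{P}$ be a fine zonotopal tiling of $Z(V)$. Then there exists a choice of triangulations $\mathcal{T}_I$, one of the link region $\mathcal{R}(I)$ for each $I$ in the set $\{I\subseteq[n]:\Pi_{I,B}\in\mathcal{P}\text{ for some }B\}$, such that $\mathcal{P}$ is constructed by the following procedure: (i) Let $\mathcal{I}^{(0)}=\{\varnothing\}$. (ii) For $0\le k\le n-d-1$ and every $I\in\mathcal{I}^{(k)}$, let $\mathcal{R}(I)$ be the link region computed from the already constructed sets $\mathcal{P}^{(0)},\dots,\mathcal{P}^{(k-1)}$ by $$\mathcal{R}(I)=\mathrm{conv}(\{a_i\}_{i\notin I})\setminus\bigcup_{r=0}^{k-1}E^{(r)}(I),$$ and let $\mathcal{T}_I$ be its triangulation. With $\Delta_B:=\mathrm{conv}(\{a_b\}_{b\in B})$, the set $\mathcal{P}^{(k)}:=\{\Pi_{I,B}\in\mathcal{P}:|I|=k\}$ is given by $$\mathcal{P}^{(k)}=\{\Pi_{I,B}:I\in\mathcal{I}^{(k)},\ \Delta_B\in\mathcal{T}_I\}.$$ (iii) Let $\mathcal{I}^{(k+1)}=\{I\sqcup\{b\}:\Pi_{I,B}\in\mathcal{P}^{(k)},\ b\in B,\ \mathcal{R}(I\sqcup\{b\})\ne\varnothing\}$. (iv) Repeat (ii) and (iii) until $k=n-d-1$, at which point $\mathcal{I}^{(k+1)}=\varnothing$. Then $\mathcal{P}=\bigsqcup_{k=0}^{n-d-1}\mathc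al{P}^{(k)}$.
   Context: Notation: $[n]=\{1,\dots,n\}$, $|\cdot|$ is cardinality, $\sqcup$ is disjoint union, $d\ge1$. The configuration $A$ is indexed by $[n]$; repeated points and affine dependencies are allowed. Zonotope and tilings: $v_i=(a_i,1)\in\mathbb{R}^{d+1}$, $V=(v_1,\dots,v_n)$, $[0,v_i]=\{\alpha v_i:0\le\alpha\le1\}$, and $Z(V)=\sum_{i=1}^n[0,v_i]$ (Minkowski sum). For disjoint $I,B\subseteq[n]$ with $|B|=d+1$ and $(a_b)_{b\in B}$ affinely independent, the tile is $\Pi_{I,B}=\sum_{i\in I}v_i+\sum_{b\in B}[0,v_b]$. Its faces are $\Pi_{J,C}=\sum_{j\in J}v_j+\sum_{c\in C}[0,v_c]$ with $C\subseteq B$ and $I\subseteq J\subseteq I\sqcup(B\setminus C)$. Tiles and faces are labelled by their index pairs. A fine zonotopal tiling of $Z(V)$ is a collection $\mathcal{P}$ of such tiles forming a polyhedral subdivision of $Z(V)$: the tiles cover $Z(V)$, distinct tiles have disjoint interiors, and any two tiles intersect in a (possibly empty) common face, i.e. one carrying the same label $(J,C)$ in both tiles. Triangulations: a triangulation of a region (a union of convex hulls of subsets of points of $A$) is a collection of $d$-dimensional simplices with vertices in $A$ whose union is the region and any two of which share a common face, possibly empty. The simplices of $\mathcal{T}_I$ are understood as labelled by their vertex index sets $B\subseteq[n]\setminus I$, so $\Delta_B\in\mathcal{T}_I$ means that the index set $B$ is one of those forming $\mathcal{T}_I$. Link regions: for $Q\subseteq[n]$ and $r\ge0$, $$\mathcal{E}^{(r)}(Q)=\{\Pi_{I,B}\in\mathcal{P}^{(r)}:B\cap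 Q=\varnothing,\ I\subseteq Q\},\qquad E^{(r)}(Q)=\bigcup_{\Pi_{I,B}\in\mathcal{E}^{(r)}(Q)}\mathrm{conv}(\{a_b\}_{b\in B}).$$ The link region of $Q$, $|Q|=k$, is $\mathcal{R}(Q)=E^{(k)}(Q)$; equivalently it is $\mathrm{conv}(\{a_i\}_{i\notin Q})\setminus\bigcup_{r=0}^{k-1}E^{(r)}(Q)$, where the set difference is understood up to boundary and lower-dimensional parts (i.e. replaced by the closure of its interior). In particular $\mathcal{R}(Q)\neq\varnothing$ means nonempty interior. *)

(* Defs.v *)
From mathcomp Require Import all_boot all_order all_algebra.
From mathcomp Require Import all_classical all_reals all_analysis.
Set Implicit Arguments.
Unset Strict Implicit.
Unset Printing Implicit Defensive.
Import Order.TTheory GRing.Theory Num.Theory.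
Import numFieldNormedType.Exports.
Local Open Scope classical_set_scope.
Local Open Scope ring_scope.

Section Configuration.
Context {R : realType} {d n : nat}.
Variable a : 'I_n -> 'rV[R]_d.

Definition affinely_spanning : Prop :=
  forall x : 'rV[R]_d, exists c : 'I_n -> R,
    \sum_i c i = 1 /\ x = \sum_i c i *: a i.

Definition affinely_independent (B : {set 'I_n}) : Prop :=
  forall c : 'I_n -> R,
    \sum_(b in B) c b = 0 -> \sum_(b in B) c b *: a b = 0 ->
    forall b, b \in B -> c b = 0.

(* The convex hull of the points indexed by S; it is empty when S is. *)
Definition hull (S : {set 'I_n}) : set 'rV[R]_d :=
  [set x | exists c : 'I_n -> R,
    [/\ forall i, i \in S -> 0 <= c i,
        \sum_(i in S) c i = 1 &
        x = \sum_(i in S) c i *: a i]].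

Definition lift_vec (i : 'I_n) : 'rV[R]_(d + 1) := row_mx (a i) (const_mx 1).

(* The Minkowski sum of the segments [0, v_i] over all i. *)
Definition zonotope : set 'rV[R]_(d + 1) :=
  [set x | exists c : 'I_n -> R,
    (forall i, 0 <= c i <= 1) /\ x = \sum_i c i *: lift_vec i].

(* Tiles and their faces are represented by their labels (I, B). *)
Local Notation label := ({set 'I_n} * {set 'I_n})%type.

(* The point set Pi_{I,B}: the vectors v_i, i in I, plus the Minkowski sum of
   the segments [0, v_b], b in B. *)
Definition cell (t : label) : set 'rV[R]_(d + 1) :=
  [set x | exists c : 'I_n -> R,
    (forall b, b \in t.2 -> 0 <= c b <= 1) /\
    x = \sum_(i in t.1) lift_vec i + \sum_(b in t.2) c b *: lift_vec b].

Definition is_tile (t : label) : Prop :=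
  [/\ [disjoint t.1 & t.2]%B, #|t.2| = d.+1 & affinely_independent t.2].

Definition face_of (f t : label) : bool :=
  [&& f.2 \subset t.2, t.1 \subset f.1 &
      f.1 \subset (t.1 :|: (t.2 :\: f.2))%SET].

Definition fine_zonotopal_tiling (P : {set label}) : Prop :=
  [/\ forall t, t \in P -> is_tile t,
      \bigcup_(t in [set` P]) cell t = zonotope,
      forall s t, s \in P -> t \in P -> s <> t ->
        interior (cell s) `&` interior (cell t) = set0 &
      forall s t, s \in P -> t \in P ->
        cell s `&` cell t = set0 \/
        exists f : label,
          [/\ face_of f s, face_of f t & cell s `&` cell t = cell f]].

(* T is a collection of vertex index sets contained in S. Simplices being
   labelled, a common face of B and B' carries the same label C in both; the
   empty face is C = set0. *)
Definition triangulation (S : {set 'I_n}) (T : {set {set 'I_n}})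
    (X : set 'rV[R]_d) : Prop :=
  [/\ forall B, B \in T ->
        [/\ B \subset S, #|B| = d.+1 & affinely_independent B],
      \bigcup_(B in [set` T]) hull B = X &
      forall B B', B \in T -> B' \in T ->
        exists C : {set 'I_n},
          [/\ C \subset B, C \subset B' & hull B `&` hull B' = hull C]].

Definition level (P : {set label}) (r : nat) : {set label} :=
  [set t in P | #|t.1| == r]%SET.

Definition link_tiles (P : {set label}) (r : nat) (Q : {set 'I_n}) :
    {set label} :=
  [set t in level P r | [disjoint t.2 & Q]%B && (t.1 \subset Q)]%SET.

Definition link_union (P : {set label}) (r : nat) (Q : {set 'I_n}) :
    set 'rV[R]_d :=
  \bigcup_(t in [set` link_tiles P r Q]) hull t.2.

Definition link_region (P : {set label}) (Q : {set 'I_n}) :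
    set 'rV[R]_d :=
  link_union P #|Q| Q.

(* The region conv(a_i : i notin Q) minus E^(0)(Q), ..., E^(k-1)(Q), where the
   E^(r) come from the tiles in H only. The set difference is regularized,
   i.e. replaced by the closure of its interior. *)
Definition residual_region (H : {set label}) (k : nat)
    (Q : {set 'I_n}) : set 'rV[R]_d :=
  closure (interior
    (hull (~: Q)%SET `\` \bigcup_(r in `I_k) link_union H r Q)).

Section Procedure.
Variable T : {set 'I_n} -> {set {set 'I_n}}.

Definition new_tiles (J : {set {set 'I_n}}) : {set label} :=
  [set t | (t.1 \in J) && (t.2 \in T t.1)]%SET.

(* state k is the pair of I^(k) and of P^(0) :|: ... :|: P^(k-1), as produced
   from the family T alone. A region is nonempty when its interior is. *)
Fixpoint state (k : nat) : {set {set 'I_n}} * {set label} :=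
  if k is k'.+1 then
    let: (J, H) := state k' in
    let H' := (H :|: new_tiles J)%SET in
    ([set K | [exists t in new_tiles J, exists b in t.2,
                 K == t.1 :|: [set b]] &&
              `[< interior (residual_region H' k'.+1 K) !=set0 >]]%SET, H')
  else ([set finset.set0]%SET, finset.set0).

Definition proc_index (k : nat) : {set {set 'I_n}} := (state k).1.

Definition proc_tiles (k : nat) : {set label} :=
  new_tiles (proc_index k).

Definition proc_region (k : nat) (I : {set 'I_n}) : set 'rV[R]_d :=
  residual_region (state k).2 k I.

(* P is the output of the procedure run with the family T, which is required
   to triangulate the regions encountered along the way. *)
Definition constructed_by (P : {set label}) : Prop :=
  [/\ forall k I, (k <= n - d.+1)%N -> I \in proc_index k ->
        triangulation (~: I)%SET (T I) (proc_region k I),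
      forall k, (k <= n - d.+1)%N -> level P k = proc_tiles k,
      proc_index (n - d.+1).+1 = finset.set0,
      P = (\bigcup_(k < (n - d.+1).+1) proc_tiles k)%SET &
      forall k l, (k <= n - d.+1)%N -> (l <= n - d.+1)%N -> k <> l ->
        [disjoint proc_tiles k & proc_tiles l]%B].

End Procedure.
End Configuration.

(* Main.v *)
(* A fine tiling is the same thing as a section of the projection of the cube
   [0, 1]^n onto the zonotope that is affine on the tiles. Following this section
   along lines of direction v_i shows that deleting i from the labels, and
   dropping the tiles with i in B, again gives such a section as long as the
   remaining vectors span. Deleting all of Q and looking near the origin, the
   tiles with I inside Q and B disjoint from Q triangulate conv(a_i : i notin Q);
   those with |I| < |Q| cover the part that the procedure removes, and the rest,
   those with I = Q, form the link region. So T_I = {B : Pi_(I,B) in P} works as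
   soon as the procedure reaches every label I, that is, as soon as v_I is joined
   to the bottom vertex of some tile by an edge of that tile going down from v_I;
   this is seen in the fan of the tiles around v_I. *)
Require Import Defs.
From mathcomp Require Import all_boot all_order all_algebra.
From mathcomp Require Import all_classical all_reals all_analysis.
From mathcomp Require Import ring lra.
Set Implicit Arguments.
Unset Strict Implicit.
Unset Printing Implicit Defensive.
Import Order.TTheory GRing.Theory Num.Theory.
Import numFieldNormedType.Exports.
Local Open Scope classical_set_scope.
Local Open Scope ring_scope.

(** * Finite closed covers of an interval *)

(** The section is never handled as a continuous map. It is a finite family of affine pieces
    [coords], one per tile, and labelled common faces are what makes two pieces agree at a shared
    point. Deletion and the walk around a vertex then use limits only along lines, where finite
    covers by closed sets suffice. The delicate point of deletion is that both covering and
    agreement must survive. Agreement follows from a monotone quantity along lines of direction v_i;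
    covering is proved first where a line has room on the negative side, and reaches the boundary by
    closedness. The last coordinate 1 of every v_i matters twice. All lifts of a point have the same
    total weight, so below weight 1 no coordinate of a lift can equal 1: this is the meaning of
    being near the origin. And -v_I has negative height, so a walk towards it must leave the cones
    spanned by the v_j. Regions are only compared up to boundary, which is harmless because an open
    simplex with I = Q misses all removed simplices and is dense in its closed simplex. *)

Section ClosedCover.
Context {R : realType} {T : choiceType}.
Implicit Types (A : T -> set R) (ts : seq T).

(** A finite union of closed sets is closed, so it contains a limit of points that it covers. This
    is how a tile at a degenerate point is obtained from tiles at nearby points. *)
Lemma closed_cover_left A ts a b : a < b ->
  (forall t, t \in ts -> closed (A t)) ->
  (forall s, a < s <= b -> exists2 t, t \in ts & A t s) ->
  exists2 t, t \in ts & A t a.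
Proof.
move=> ab cA covA; pose B := \bigcup_(t in [set` ts]) A t.
have cB : closed B by apply: closed_bigcup.
suff [t /= tts At] : B a by exists t.
apply: cB => U [e /= e0 aU].
have me : 0 < Num.min (e / 2) (b - a).
  by rewrite lt_min divr_gt0 //= subr_gt0.
pose s := a + Num.min (e / 2) (b - a).
have [|t tts ts'] := covA s.
  by rewrite /s ltrDl me /= -lerBrDl ge_min lexx orbT.
exists s; split; first by exists t.
apply: aU; rewrite /ball /= /s opprD addrA subrr sub0r normrN gtr0_norm //.
by rewrite gt_min; apply/orP; left; lra.
Qed.

(* Jump to the last point of the piece containing the left end, then to
   another piece containing that point: no piece is visited twice. *)
Lemma closed_cover_chain A ts (E : R -> R -> Prop) a b : a <= b ->
  (forall x y z, E x y -> E y z -> E x z) ->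
  (forall t, t \in ts -> closed (A t)) ->
  (forall s, a <= s <= b -> exists2 t, t \in ts & A t s) ->
  (forall t s s', t \in ts -> a <= s -> s <= s' -> s' <= b ->
     A t s -> A t s' -> E s s') ->
  E a b.
Proof.
move=> + Etr; have [k] := ubnP (size ts).
elim: k ts a => // k IHk ts a; rewrite ltnS => szts ab cA covA EA.
have [|t tts Aa] := covA a; first by rewrite lexx ab.
pose D := [set s | [/\ a <= s, s <= b & A t s]].
have Da : D a by split.
have supD : has_sup D by split; [exists a | exists b => s []].
pose m := sup D.
have am : a <= m by apply: ub_le_sup => //; case: supD.
have mb : m <= b by apply: ge_sup => [|s []]; case: supD.
have Am : A t m.
  apply: (cA t tts) => U [e /= e0 mU].
  have [s [as_ sb As] ms] := sup_adherent e0 supD.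
  exists s; split=> //; apply: mU; rewrite /ball /=.
  have sm : s <= m by apply: ub_le_sup; [case: supD | split].
  by rewrite ger0_norm ?subr_ge0 // ltrBlDl -ltrBlDr.
have Eam : E a m by apply: (EA t).
have [bm|mb'] := leP b m.
  by rewrite (_ : b = m) //; apply: le_anti; rewrite bm mb.
apply: (Etr _ m) => //.
pose ts' := [seq u <- ts | u != t].
have ts'P u : u \in ts' -> u \in ts by rewrite mem_filter => /andP[].
have cov' s : m < s <= b -> exists2 u, u \in ts' & A u s.
  move=> /andP[ms sb]; have sa : a <= s by apply: le_trans (ltW ms).
  have [|u uts Au] := covA s; first by rewrite sa sb.
  exists u => //; rewrite mem_filter uts andbT /=; apply/eqP => ut.
  move: ms; apply/negP.
  rewrite -leNgt; apply: ub_le_sup; first by case: supD.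
  by split; rewrite -?ut.
apply: (IHk ts') => //.
- apply: leq_trans szts; rewrite size_filter -(count_predC (pred1 t) ts).
  by rewrite -add1n leq_add2r -has_count has_pred1.
- by move=> u /ts'P /cA.
(* At [m] itself only the discarded piece [t] is known. The other pieces cover everything just to
   the right of [m], hence reach [m] by closedness. *)
- move=> s /andP[]; rewrite le_eqVlt => /predU1P[<- _|ms sb].
    apply: (closed_cover_left mb') cov' => u /ts'P; exact: cA.
  by apply: cov'; rewrite ms sb.
- by move=> u s s' /ts'P uts ms; apply: EA => //; apply: le_trans ms.
Qed.

End ClosedCover.

(** * Sections over zonotopes and deletion *)

Section VectorConfiguration.
Context {R : realType} {n m : nat} (V : 'M[R]_(n, m)).
Local Notation label := ({set 'I_n} * {set 'I_n})%type.
Implicit Types (S B I : {set 'I_n}) (i : 'I_n) (t : label).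
Implicit Types (y : 'rV[R]_n) (p : 'rV[R]_m).

Definition supported S y := forall i, i \notin S -> y 0 i = 0.

Definition basis B :=
  #|B| = m /\ forall y, supported B y -> y *m V = 0 -> y = 0.

Definition spans S := forall p, exists2 e, supported S e & e *m V = p.

Lemma supportedD S y y' :
  supported S y -> supported S y' -> supported S (y + y').
Proof. by move=> hy hy' i iS; rewrite mxE hy ?hy' ?addr0. Qed.

Lemma supportedZ S c y : supported S y -> supported S (c *: y).
Proof. by move=> hy i iS; rewrite mxE hy ?mulr0. Qed.

Lemma supportedS S S' y : S \subset S' -> supported S y -> supported S' y.
Proof.
move=> /fintype.subsetP SS' hy i iS; apply: hy.
by apply: contra iS; apply: SS'.
Qed.

Lemma supported_delta S i : i \in S -> supported S (delta_mx 0 i).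
Proof. by move=> iS j; rewrite mxE /= => jS; case: eqVneq jS => // ->; rewrite iS. Qed.

(* p *m dual_basis B is the vector of coordinates of p in the basis B. *)
Definition dual_basis B : 'M[R]_(m, n) :=
  pinvmx (rowsub (@enum_val _ (mem B)) V) *m rowsub (@enum_val _ (mem B)) 1%:M.

Lemma supported_dual B p : supported B (p *m dual_basis B).
Proof.
move=> i iB; rewrite mulmxA mxE big1 // => j _; rewrite !mxE.
by case: eqP => [ji|]; rewrite ?mulr0 //; move: iB; rewrite -ji enum_valP.
Qed.

Lemma dualK B p : basis B -> p *m dual_basis B *m V = p.
Proof.
case=> cB fB; set E := @enum_val _ (mem B).
rewrite /dual_basis -/E -mulmxA -(mulmxA (pinvmx _)) mul_rowsub_mx mul1mx.
rewrite mulVpmx ?mulmx1 //.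
rewrite /row_full eqn_leq rank_leq_col /= -{1}cB.
rewrite row_leq_rank; apply: inj_row_free => v v0.
have : v *m rowsub E 1%:M = 0.
  apply: fB; last by rewrite -mulmxA mul_rowsub_mx mul1mx.
  move=> i iB; rewrite mxE big1 // => j _; rewrite !mxE.
  by case: eqP => [ji|]; rewrite ?mulr0 //; move: iB; rewrite -ji enum_valP.
move=> /rowP vE; apply/rowP => j; move: (vE (E j)); rewrite !mxE => <-.
rewrite (bigD1 j) //= !mxE eqxx mulr1 big1 ?addr0 // => k kj.
by rewrite !mxE (inj_eq enum_val_inj) (negPf kj) mulr0.
Qed.

Lemma dualVK B y : basis B -> supported B y -> y *m V *m dual_basis B = y.
Proof.
move=> bB hy; apply/eqP; rewrite -subr_eq0; apply/eqP.
apply: (proj2 bB); last by rewrite mulmxBl dualK // subrr.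
by apply: supportedD; [exact: supported_dual|rewrite -scaleN1r; exact: supportedZ].
Qed.

Lemma basis_spans B S : basis B -> B \subset S -> spans S.
Proof.
move=> bB BS p; exists (p *m dual_basis B); last exact: dualK.
exact: supportedS BS (supported_dual _).
Qed.

Definition indicator I : 'rV[R]_n := \row_i (i \in I)%:R.

(* The face of the cube [0, 1]^n whose projection under V is the tile t. *)
Definition cube t y : bool :=
  [forall i, if i \in t.1 then y 0 i == 1
             else if i \in t.2 then 0 <= y 0 i <= 1 else y 0 i == 0].

(* The point of the affine span of the cube face t lying over p. *)
Definition coords t p : 'rV[R]_n :=
  indicator t.1 + (p - indicator t.1 *m V) *m dual_basis t.2.

Lemma coordsK t p : basis t.2 -> coords t p *m V = p.
Proof. by move=> bt; rewrite mulmxDl dualK // addrC subrK. Qed.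

Lemma cube01 t y : cube t y -> forall i, 0 <= y 0 i <= 1.
Proof.
move=> /forallP cy i; have := cy i.
by do 2?case: ifP => _ //; move=> /eqP ->; rewrite lexx ler01.
Qed.

Lemma cube1 t y i : cube t y -> i \in t.1 -> y 0 i = 1.
Proof. by move=> /forallP/(_ i) + it; rewrite it => /eqP. Qed.

Lemma cube0 t y i : cube t y -> i \notin t.1 -> i \notin t.2 -> y 0 i = 0.
Proof. by move=> /forallP/(_ i) + /negPf it /negPf it'; rewrite it it' => /eqP. Qed.

Lemma cube_coords t y : basis t.2 -> cube t y -> coords t (y *m V) = y.
Proof.
move=> bt cy; rewrite /coords -mulmxBl dualVK ?subrK //; first by rewrite addrC subrK.
move=> i it; rewrite !mxE; case: (boolP (i \in t.1)) => i1.
  by rewrite (cube1 cy) ?subrr.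
by rewrite (cube0 cy) ?subrr.
Qed.

Lemma coords_line t p w s :
  coords t (p + s *: w) = coords t p + s *: (w *m dual_basis t.2).
Proof. by rewrite /coords scalemxAl -[RHS]addrA -mulmxDl [p + _ - _]addrAC. Qed.

Lemma coords_notin t p i : i \notin t.2 -> coords t p 0 i = (i \in t.1)%:R.
Proof. by move=> it; rewrite /coords mxE (supported_dual _ it) addr0 mxE. Qed.

Lemma cube_coordsP t p : [disjoint t.1 & t.2]%B ->
  cube t (coords t p) = [forall i in t.2, 0 <= coords t p 0 i <= 1].
Proof.
move=> dt; apply/forallP/forall_inP => [c i it|c i]; have := c i.
  by rewrite it (disjointFl dt).
case: (boolP (i \in t.2)) => it; first by rewrite (disjointFl dt) // => /(_ isT).
by rewrite coords_notin //; case: (i \in t.1) => _; rewrite eqxx.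
Qed.

Lemma closed_affine_ge0 (a b : R) : closed [set s : R | 0 <= a + s * b].
Proof.
apply: (@preimage_closed _ _ (fun s : R => a + s * b) [set x | 0 <= x]).
  move=> s _; apply: cvgD; [exact: cvg_cst|].
  by apply: cvgM; [exact: cvg_id|exact: cvg_cst].
exact: closed_ge.
Qed.

Lemma closed_cube t p w : closed [set s | cube t (coords t (p + s *: w))].
Proof.
pose u := w *m dual_basis t.2; pose l := coords t p.
have lE s i : coords t (p + s *: w) 0 i = l 0 i + s * u 0 i.
  by rewrite coords_line !mxE.
pose F i := if i \in t.1 then
    [set s : R | 0 <= (l 0 i - 1) + s * u 0 i] `&`
    [set s | 0 <= (1 - l 0 i) + s * - u 0 i]
  else if i \in t.2 then
    [set s | 0 <= l 0 i + s * u 0 i] `&` [set s | 0 <= (1 - l 0 i) + s * - u 0 i]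
  else
    [set s | 0 <= l 0 i + s * u 0 i] `&` [set s | 0 <= (- l 0 i) + s * - u 0 i].
rewrite (_ : [set _ | _] = \bigcap_i F i).
  apply: closed_bigI => i _; rewrite /F.
  by case: ifP => _; [|case: ifP => _]; apply: closedI; apply: closed_affine_ge0.
apply/seteqP; split=> s /=.
  move=> /forallP cs i _; move: (cs i); rewrite lE /F.
  case: ifP => _; first by move=> /eqP h; split=> /=; lra.
  case: ifP => _; first by move=> /andP[h1 h2]; split=> /=; lra.
  by move=> /eqP h; split=> /=; lra.
move=> cs; apply/forallP => i; move: (cs i Logic.I); rewrite lE /F.
case: ifP => _; first by case=> /= h1 h2; apply/eqP; lra.
case: ifP => _; first by case=> /= h1 h2; apply/andP; split; lra.
by case=> /= h1 h2; apply/eqP; lra.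
Qed.

(** Only the first component is cut: the intended tiles are those of [tiles_on], whose second
    component lies in [S] already. *)
Definition restr S t : label := (t.1 :&: S, t.2)%SET.

Definition in_cell S t p := cube (restr S t) (coords (restr S t) p).

Definition zonotope_on S : set 'rV[R]_m :=
  [set p | exists x, [/\ supported S x, forall i, 0 <= x 0 i <= 1 & x *m V = p]].

Context (P : {set label}).
Context (P_tiles : forall t, t \in P -> [disjoint t.1 & t.2]%B /\ basis t.2).

Definition tiles_on S := [set t in P | t.2 \subset S]%SET.

(* The tiles with B contained in S, once restricted to S, lift to a section of
   the projection of the cube [0, 1]^S onto the zonotope of S. *)
Definition has_section S :=
  (forall p, zonotope_on S p -> exists2 t, t \in tiles_on S & in_cell S t p) /\
  (forall p t t', t \in tiles_on S -> t' \in tiles_on S -> in_cell S t p ->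
     in_cell S t' p -> coords (restr S t) p = coords (restr S t') p).

(** The tile picked is immaterial once [has_section] holds; 0 is a dummy value at points lying in no
    cell. *)
Definition sect S p :=
  if [pick t in tiles_on S | in_cell S t p] is Some t then coords (restr S t) p else 0.

Lemma tiles_onP S t : t \in tiles_on S ->
  [/\ t \in P, t.2 \subset S, basis t.2 & [disjoint (restr S t).1 & t.2]%B].
Proof.
rewrite inE => /andP[tP tS]; have [dt bt] := P_tiles tP; split=> //.
exact: disjointWl (subsetIl _ _) dt.
Qed.

Lemma sectE S p t : has_section S -> t \in tiles_on S -> in_cell S t p ->
  sect S p = coords (restr S t) p.
Proof.
move=> [_ uS] tS ct; rewrite /sect; case: pickP => [u /andP[uP cu]|/(_ t)].
  exact: uS.
by rewrite tS ct.
Qed.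

Lemma cube_in_cell S t y : t \in tiles_on S -> cube (restr S t) y ->
  in_cell S t (y *m V).
Proof. by move=> /tiles_onP[_ _ bt _] cy; rewrite /in_cell (@cube_coords (restr S t)). Qed.

Lemma sect_cube S t y : has_section S -> t \in tiles_on S -> cube (restr S t) y ->
  sect S (y *m V) = y.
Proof.
move=> gS tS cy; rewrite (sectE gS tS (cube_in_cell tS cy)).
by apply: cube_coords => //; have [] := tiles_onP tS.
Qed.

Lemma cube_supported S t y : t \in tiles_on S -> cube (restr S t) y -> supported S y.
Proof.
move=> /tiles_onP[_ tS _ _] cy i iS; apply: (cube0 cy) => /=.
  by rewrite inE (negPf iS) andbF.
by apply: contra iS; exact: fintype.subsetP.
Qed.

Lemma in_cell_convex S t p w (q r q' : R) : t \in tiles_on S -> q <= r -> r <= q' ->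
  in_cell S t (p + q *: w) -> in_cell S t (p + q' *: w) ->
  in_cell S t (p + r *: w).
Proof.
move=> /tiles_onP[_ _ _ dt] qr rq'; rewrite /in_cell !(cube_coordsP _ dt).
move=> /forall_inP c /forall_inP c'; apply/forall_inP => i it.
move: (c i it) (c' i it); rewrite !coords_line.
move: (coords _ p) (w *m _) => y z; rewrite !mxE; move: (y 0 i) (z 0 i) => a b.
move=> /andP[h1 h2] /andP[h3 h4]; apply/andP.
have [b0|b0] := leP 0 b.
  have := ler_wpM2r b0 qr; have := ler_wpM2r b0 rq'; lra.
have := ler_wnM2r (ltW b0) qr; have := ler_wnM2r (ltW b0) rq'; lra.
Qed.

(** * Deletion of a single vector *)

Section Deletion.
Context (S : {set 'I_n}) (i : 'I_n).
Context (iS : i \notin S).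
Local Notation S' := (i |: S)%SET.
Local Notation e_i := (delta_mx 0 i : 'rV[R]_n).
Local Notation v := (e_i *m V).

Lemma tiles_on_del t : t \in tiles_on S' -> i \notin t.2 -> t \in tiles_on S.
Proof.
rewrite !inE => /andP[-> /fintype.subsetP tS] it; apply/fintype.subsetP => j jt.
by have := tS j jt; rewrite !inE => /predU1P[ji|//]; rewrite -ji jt in it.
Qed.

Lemma tiles_on_add t : t \in tiles_on S -> t \in tiles_on S' /\ i \notin t.2.
Proof.
rewrite !inE => /andP[-> /fintype.subsetP tS]; split.
  by apply/fintype.subsetP => j /tS jS; rewrite !inE jS orbT.
by apply: contra iS; exact: tS.
Qed.

(** Deleting i translates the tile by -v_i when i is in I and leaves it in place otherwise; the
    factor [(i \in t.1)%:R] treats both cases at once. *)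
Lemma coords_del t p : t \in tiles_on S ->
  coords (restr S' t) (p + (i \in t.1)%:R *: v) =
  coords (restr S t) p + (i \in t.1)%:R *: e_i.
Proof.
move=> tS; have it := proj2 (tiles_on_add tS).
have -> : coords (restr S' t) = fun q => indicator (restr S' t).1 +
    (q - indicator (restr S' t).1 *m V) *m dual_basis t.2 by [].
have -> : indicator (restr S' t).1 = indicator (restr S t).1 + (i \in t.1)%:R *: e_i.
  apply/rowP => j; rewrite !mxE !inE eqxx /=.
  case: (eqVneq j i) => [->|ji] /=; last by rewrite mulr0 addr0.
  by rewrite (negPf iS) andbT andbF add0r mulr1.
by rewrite [(_ + _) *m V]mulmxDl -scalemxAl opprD addrACA subrr addr0 /coords addrAC.
Qed.

Lemma in_cell_del t p : t \in tiles_on S ->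
  in_cell S' t (p + (i \in t.1)%:R *: v) = in_cell S t p.
Proof.
move=> tS; have [tS' it] := tiles_on_add tS.
have [_ _ _ dt] := tiles_onP tS; have [_ _ _ dt'] := tiles_onP tS'.
rewrite /in_cell (cube_coordsP _ dt) (cube_coordsP _ dt') coords_del //.
apply: eq_forallb_in => j jt.
rewrite !mxE (_ : j == i = false) ?mulr0 ?addr0 //.
by apply/eqP => ji; rewrite -ji jt in it.
Qed.

Lemma zonotope_on_add p q : zonotope_on S p -> 0 <= q <= 1 -> zonotope_on S' (p + q *: v).
Proof.
move=> [x [xS x01 <-]] q01; exists (x + q *: e_i).
split; last by rewrite mulmxDl scalemxAl.
  apply: supportedD; first exact: (supportedS (subsetU1 _ _)).
  by apply: supportedZ; apply: supported_delta; rewrite setU11.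
move=> j; rewrite !mxE; case: (eqVneq j i) => [->|_] /=.
  by rewrite xS // add0r mulr1.
by rewrite mulr0 addr0.
Qed.

Context (gS' : has_section S').

Let G p (q : R) := sect S' (p + q *: v).

Lemma sect_line p q t : t \in tiles_on S' -> in_cell S' t (p + q *: v) ->
  G p q = coords (restr S' t) p + q *: (v *m dual_basis t.2).
Proof. by move=> tS ct; rewrite /G (sectE gS' tS ct) coords_line. Qed.

Lemma sect_line_in p q t : t \in tiles_on S' -> in_cell S' t (p + q *: v) ->
  i \in t.2 -> G p q = coords (restr S' t) p + q *: e_i.
Proof.
move=> tS ct it; rewrite (sect_line tS ct) dualVK //; last exact: supported_delta.
by have [] := tiles_onP tS.
Qed.

Lemma sect_line_notin p q t : t \in tiles_on S' -> in_cell S' t (p + q *: v) ->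
  i \notin t.2 -> G p q 0 i = (i \in t.1)%:R.
Proof.
move=> tS ct it; rewrite /G (sectE gS' tS ct) coords_notin //=.
by rewrite !inE eqxx andbT.
Qed.

Lemma line_chain p (E : R -> R -> Prop) a b : a <= b ->
  (forall r1 r2 r3, E r1 r2 -> E r2 r3 -> E r1 r3) ->
  (forall q, a <= q <= b -> zonotope_on S' (p + q *: v)) ->
  (forall t q q', t \in tiles_on S' -> a <= q -> q <= q' -> q' <= b ->
     in_cell S' t (p + q *: v) -> in_cell S' t (p + q' *: v) -> E q q') ->
  E a b.
Proof.
move=> ab Etr zab EA.
apply: (@closed_cover_chain _ _ (fun t => [set q | in_cell S' t (p + q *: v)])
          (enum (tiles_on S'))) => //.
- by move=> t _; exact: closed_cube.
- by move=> q /zab/(proj1 gS')[t tP ct]; exists t; rewrite ?mem_enum.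
- by move=> t q q'; rewrite mem_enum; exact: EA.
Qed.

(* On a line in direction v_i, the coordinate i of the section minus the
   parameter is nonincreasing, and it is constant only as long as the line
   stays in tiles having v_i as an edge direction. *)
Lemma sect_edge p q : zonotope_on S p -> sect S' p 0 i = 0 -> sect S' (p + v) 0 i = 1 ->
  0 <= q <= 1 -> sect S' (p + q *: v) = sect S' p + q *: e_i.
Proof.
move=> zp g0 g1 /andP[q0 q1].
pose H r := G p r - r *: e_i; pose h r := H r 0 i.
have hE r : h r = G p r 0 i - r by rewrite /h !mxE !eqxx mulr1.
(* The second half has to travel with the first: equality of [h] at the two ends of a chain forces
   equality on every link, and each link then gives equality of the whole vector [H]. *)
pose E r r' := h r' <= h r /\ (h r = h r' -> H r = H r').
have Etr r1 r2 r3 : E r1 r2 -> E r2 r3 -> E r1 r3.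
  move=> [h12 e12] [h23 e23]; split; first exact: le_trans h12.
  move=> e13; rewrite e12 ?e23 //; lra.
have EA t r r' : t \in tiles_on S' -> r <= r' -> in_cell S' t (p + r *: v) ->
    in_cell S' t (p + r' *: v) -> E r r'.
  move=> tP rr' c c'; rewrite /E !hE; case: (boolP (i \in t.2)) => it.
    have HE : H r = H r' by rewrite /H !(@sect_line_in _ _ t) // !addrK.
    by split=> //; rewrite -!hE /h HE.
  rewrite !(@sect_line_notin _ _ t) //; split; first by lra.
  by move=> rr; have -> : r = r' by lra.
have E01 r r' : 0 <= r -> r <= r' -> r' <= 1 -> E r r'.
  move=> r0 rr' r1; apply: (line_chain rr' Etr (p := p)).
    move=> s /andP[rs sr']; apply: zonotope_on_add => //; apply/andP; split; lra.
  by move=> t s s' tP rs ss' sr'; exact: EA.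
have [h0q e0q] := E01 0 q (lexx _) q0 q1; have [hq1 _] := E01 q 1 q0 q1 (lexx _).
have h0 : h 0 = 0 by rewrite hE /G scale0r addr0 g0 subrr.
have h1 : h 1 = 0 by rewrite hE /G scale1r g1 subrr.
have : H 0 = H q by apply: e0q; apply: le_anti; rewrite h0q h0 -h1 hq1.
by rewrite /H /G !scale0r addr0 subr0 => ->; rewrite subrK.
Qed.

Lemma sect_del t p : t \in tiles_on S -> in_cell S t p ->
  sect S' (p + (i \in t.1)%:R *: v) = coords (restr S t) p + (i \in t.1)%:R *: e_i.
Proof.
move=> tS ct; have [tS' _] := tiles_on_add tS.
by rewrite (sectE gS' tS') ?in_cell_del // coords_del.
Qed.

Lemma in_cell_zonotope_on t p : t \in tiles_on S -> in_cell S t p -> zonotope_on S p.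
Proof.
move=> tS ct; exists (coords (restr S t) p); split.
- exact: cube_supported ct.
- exact: cube01 ct.
- by apply: coordsK; have [] := tiles_onP tS.
Qed.

Lemma coords_restr_notin t p : t \in tiles_on S -> coords (restr S t) p 0 i = 0.
Proof.
move=> tS; have [_ it] := tiles_on_add tS.
by rewrite coords_notin //= inE (negPf iS) andbF.
Qed.

(** Tiles that treat i alike are compared at one point of the larger zonotope. Otherwise the section
    has coordinate i equal to 0 at [p] and to 1 at [p + v]; by [sect_edge] it runs along an edge of
    the cube in between, so the two lifts agree apart from i. *)
Lemma del_unique p t t' : t \in tiles_on S -> t' \in tiles_on S -> in_cell S t p ->
  in_cell S t' p -> coords (restr S t) p = coords (restr S t') p.
Proof.
have half u u' : u \in tiles_on S -> u' \in tiles_on S -> in_cell S u p ->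
    in_cell S u' p -> i \notin u.1 -> i \in u'.1 ->
    coords (restr S u) p = coords (restr S u') p.
  move=> uS uS' cu cu' iu iu'.
  have := sect_del uS cu; have := sect_del uS' cu'.
  rewrite iu' (negPf iu) !scale1r !scale0r !addr0 => g1 g0.
  have E0 : sect S' p 0 i = 0 by rewrite g0 coords_restr_notin.
  have E1 : sect S' (p + v) 0 i = 1.
    by rewrite g1 mxE coords_restr_notin // mxE !eqxx add0r.
  have := sect_edge (in_cell_zonotope_on uS cu) E0 E1 (q := 1).
  by rewrite lexx ler01 !scale1r g0 g1 => /(_ isT)/addIr.
move=> tS tS' ct ct'; have := sect_del tS ct; have := sect_del tS' ct'.
case: (boolP (i \in t.1)) => it; case: (boolP (i \in t'.1)) => it'.
- by move=> -> /addIr.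
- by move=> _ _; apply/esym/half.
- by move=> _ _; apply: half.
- by move=> -> /addIr.
Qed.

(* Along the line p + q v_i, the sign of (coordinate i of the section) - q
   changes only at p inside a tile with i outside I and B, or at p + v_i
   inside a tile with i in I. *)
Lemma del_cover_inner p (delta : R) : 0 < delta ->
  (forall q, - delta <= q <= 0 -> zonotope_on S (p + q *: v)) ->
  exists2 t, t \in tiles_on S & in_cell S t p.
Proof.
move=> d0 zd; apply: contrapT => noS.
have {}noS t : t \in tiles_on S -> ~ in_cell S t p.
  by move=> tS ct; apply: noS; exists t.
have zp : zonotope_on S p by have := zd 0; rewrite scale0r addr0; apply; lra.
pose h q := G p q 0 i - q.
have G01 q : zonotope_on S' (p + q *: v) -> 0 <= G p q 0 i <= 1.
  by case/(proj1 gS') => t tS' ct; rewrite /G (sectE gS' tS' ct); exact: (cube01 ct).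
have zq q : - delta <= q <= 1 -> zonotope_on S' (p + q *: v).
  move=> /andP[qd q1]; have [q0|q0] := leP q 0.
    have [|x [xS x01 xE]] := zd q; first by rewrite qd q0.
    by exists x; split=> //; apply: supportedS xS; exact: subsetU1.
  by apply: zonotope_on_add => //; rewrite q1 ltW.
(* Coordinates of the section lie in [0, 1], so [h] is at least [delta] at the left end and at most
   0 at the right end. Its sign has to change. *)
have hd : 0 < h (- delta).
  have /G01/andP[] : zonotope_on S' (p + - delta *: v) by apply: zq; lra.
  by rewrite /h; lra.
have h1 : ~ 0 < h 1.
  have /G01/andP[] : zonotope_on S' (p + 1 *: v) by apply: zq; lra.
  by rewrite /h; lra.
apply: h1; move: hd; apply: (@line_chain p (fun q q' => 0 < h q -> 0 < h q')).
- lra.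
- by move=> x y z xy yz /xy.
- exact: zq.
move=> t q q' tS' qd qq' q1 ct ct'; case: (boolP (i \in t.2)) => it.
  by rewrite /h !(@sect_line_in _ _ t) // !mxE !eqxx !mulr1; lra.
have tS := tiles_on_del tS' it.
rewrite /h !(@sect_line_notin _ _ t) //.
have := noS t tS; rewrite -(in_cell_del _ tS); case: (i \in t.1) => /= nt; last first.
  rewrite !sub0r !oppr_gt0 => q0; rewrite ltNge; apply/negP => q'0; apply: nt.
  by rewrite mulr0n; apply: in_cell_convex ct ct' => //; exact: ltW.
rewrite !subr_gt0 => _; rewrite lt_neqAle q1 andbT; apply/eqP => q'1.
by apply: nt; move: ct'; rewrite q'1.
Qed.

(** A boundary point may leave the zonotope of [S] as soon as it moves along -v_i. Moving it a
    fraction [s] of the way to the centre makes room for [del_cover_inner], and closedness of the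
    cells handles s = 0. *)
Lemma del_cover p : spans S -> zonotope_on S p ->
  exists2 t, t \in tiles_on S & in_cell S t p.
Proof.
move=> spS [x [xS x01 xE]]; have [e eS eE] := spS v.
pose w := (2^-1 *: indicator S - x) *m V.
have [] := @closed_cover_left _ _ (fun t => [set s : R | in_cell S t (p + s *: w)])
  (enum (tiles_on S)) 0 1 ltr01.
- by move=> t _; exact: closed_cube.
- move=> s /andP[s0 s1].
  (* After the move towards the centre, coordinates in [S] lie in [s/2, 1 - s/2]. Since [N] bounds
     the coordinates of [e], which represents v_i over [S], a displacement of at most s/2/N uses no
     more than this slack. *)
  pose N := 1 + \sum_j `|e 0 j|.
  have eN j : `|e 0 j| <= N.
    rewrite /N (bigD1 j) //= addrCA lerDl addr_ge0 // sumr_ge0 // => k _.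
  have N0 : 0 < N by rewrite ltr_pwDl // sumr_ge0.
  have [|q /andP[qd q0]|t tS ct] := @del_cover_inner (p + s *: w) (s / 2 / N).
  + by rewrite !divr_gt0.
  + exists (x + s *: (2^-1 *: indicator S - x) + q *: e); split.
    * apply: supportedD; last exact: supportedZ.
      move=> j jS; rewrite !mxE (xS _ jS) (negPf jS) /=; ring.
    * move=> j; case: (boolP (j \in S)) => jS; last first.
        rewrite !mxE (xS _ jS) (eS _ jS) (negPf jS) /=.
        by rewrite !(mulr0, subrr, addr0) lexx ler01.
      rewrite !mxE jS /= mulr1.
      have qe : `|q * e 0 j| <= s / 2.
        rewrite normrM; apply: le_trans (_ : s / 2 / N * N <= _); last first.
          by rewrite divfK // gt_eqF.
        by apply: ler_pM => //; rewrite ler0_norm //; lra.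
      have /andP[] := x01 j; move: qe; rewrite ler_norml => /andP[].
      move: (q * _) (x 0 j) => z xj h1 h2 h3 h4.
      have := mulr_ge0 (ltW s0) h3; have := mulr_ge0 (ltW s0) (_ : 0 <= 1 - xj).
      nra.
    * by rewrite !mulmxDl -!scalemxAl xE eE.
  + by exists t; rewrite ?mem_enum.
by move=> t; rewrite mem_enum /= scale0r addr0 => tS ct; exists t.
Qed.

Lemma has_section_del : spans S -> has_section S.
Proof.
move=> spS; split; first by move=> p; exact: del_cover.
by move=> p t t'; exact: del_unique.
Qed.

End Deletion.

End VectorConfiguration.

(** * Configurations in an affine hyperplane *)

Section CausalConfiguration.
Context {R : realType} {n m : nat} (V : 'M[R]_(n, m)) (hgt : 'cV[R]_m).
Local Notation label := ({set 'I_n} * {set 'I_n})%type.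
Implicit Types (S B C I K : {set 'I_n}) (i j : 'I_n) (t : label) (y c : 'rV[R]_n).
Implicit Types (p : 'rV[R]_m).
Context (V_hgt : V *m hgt = const_mx 1).

(** The weight of a lift can thus be read off its projection, whichever tile the lift comes from. *)
Lemma weightE y : (y *m V *m hgt) 0 0 = \sum_i y 0 i.
Proof.
by rewrite -mulmxA V_hgt mxE; apply: eq_bigr => i _; rewrite mxE mulr1.
Qed.

(** * Cones of tiles at the origin *)

Definition cone S p :=
  exists c, [/\ supported S c, forall i, 0 <= c 0 i & c *m V = p].

Lemma coneS S S' p : S \subset S' -> cone S p -> cone S' p.
Proof. by move=> SS' [c [cS c0 cE]]; exists c; split=> //; apply: supportedS cS. Qed.

Lemma cone_basis B p : basis V B ->
  cone B p <-> forall i, 0 <= (p *m dual_basis V B) 0 i.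
Proof.
move=> bB; split=> [[c [cB c0 <-]] i|p0]; first by rewrite dualVK.
by exists (p *m dual_basis V B); split=> //; [exact: supported_dual|exact: dualK].
Qed.

Lemma spansS S S' : S \subset S' -> spans V S -> spans V S'.
Proof.
move=> SS' sp p; have [e eS eE] := sp p; exists e => //.
exact: supportedS eS.
Qed.

Context (P : {set label}).
Context (P_tiles : forall t, t \in P -> [disjoint t.1 & t.2]%B /\ basis V t.2).
Context (P_section : has_section V P [set: 'I_n]%SET).

Lemma has_section_spans S : spans V S -> has_section V P S.
Proof.
have [k] := ubnP #|~: S|%SET; elim: k S => // k IHk S; rewrite ltnS => cS sp.
have [S0|[i]] := set_0Vmem (~: S)%SET.
  by rewrite -[S]finset.setCK S0 finset.setC0.
rewrite inE => iS; apply: (has_section_del P_tiles iS) => //.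
apply: IHk; last exact: spansS (subsetU1 _ _) sp.
apply: leq_trans cS; apply: proper_card; rewrite properC properE subsetU1 /=.
by apply/fintype.subsetPn; exists i; rewrite ?setU11.
Qed.

Lemma disjoint_res S t : [disjoint t.1 & S]%B -> restr S t = (finset.set0, t.2).
Proof. by rewrite -setI_eq0 /restr => /eqP ->. Qed.

Lemma cube_disjoint S t c : [disjoint t.1 & S]%B -> supported t.2 c ->
  (forall i, 0 <= c 0 i <= 1) -> cube (restr S t) c.
Proof.
move=> dt ct c01; rewrite disjoint_res //; apply/forallP => i /=.
by rewrite inE; case: ifP => // /negbT it; rewrite ct.
Qed.

(** Suppose i lies in one first component only. Over the centre of the parallelepiped of B, the
    section on B and i then runs along the full edge of direction i. At its midpoint all d + 2
    coordinates, more precisely m + 1, are strictly between 0 and 1, but a tile has only m free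
    ones. *)
Lemma basis_label t t' : t \in P -> t' \in P -> t.2 = t'.2 -> t = t'.
Proof.
have sub u u' : u \in P -> u' \in P -> u.2 = u'.2 -> u'.1 \subset u.1.
  move=> uP uP' uE; apply/fintype.subsetP => i iu'; apply: contraT => iu.
  have [du bu] := P_tiles uP; have [du' bu'] := P_tiles uP'.
  have iB : i \notin u.2 by rewrite uE (disjointFr du').
  have sB : spans V u.2 by apply: basis_spans bu _.
  have gB := has_section_spans (spansS (subsetU1 i _) sB).
  pose y : 'rV[R]_n := 2^-1 *: indicator u.2.
  have uB : u \in tiles_on P u.2 by rewrite inE uP subxx.
  have uB' : u' \in tiles_on P u.2 by rewrite inE uP' uE subxx.
  have yB : supported u.2 y by move=> j jB; rewrite !mxE (negPf jB) mulr0.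
  have y01 j : 0 <= y 0 j <= 1.
    by rewrite !mxE; case: (j \in u.2); rewrite ?mulr1 ?mulr0; lra.
  have cu : cube (restr u.2 u) y by apply: cube_disjoint.
  have cu' : cube (restr u.2 u') y by apply: cube_disjoint; rewrite ?uE // -uE.
  have cell_u := cube_in_cell P_tiles uB cu.
  have g0 := sect_del P_tiles iB gB uB cell_u.
  have g1 := sect_del P_tiles iB gB uB' (cube_in_cell P_tiles uB' cu').
  rewrite (negPf iu) iu' !scale0r !addr0 !scale1r in g0 g1.
  rewrite !cube_coords // in g0 g1.
  have zy := in_cell_zonotope_on P_tiles uB cell_u.
  have half01 : 0 <= (2^-1 : R) <= 1 by lra.
  have := sect_edge P_tiles iB gB zy (q := 2^-1).
  rewrite half01 g0 g1 !mxE (negPf iB) mulr0 add0r !eqxx => /(_ erefl erefl isT).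
  have [w wP cw] := proj1 gB _ (zonotope_on_add iB zy half01).
  rewrite (sectE gB wP cw) => /rowP wE.
  have [_ _ [cardw _] _] := tiles_onP P_tiles wP.
  suff : i |: u.2 \subset w.2.
    move=> /subset_leq_card; rewrite cardsU1 iB cardw.
    by rewrite (proj1 bu) ltnn.
  apply/fintype.subsetP => j; rewrite !inE => ju; apply: contraT => jw.
  have := wE j; rewrite coords_notin // !mxE eqxx /=.
  have [->|/negPf ji] := eqVneq j i.
    by rewrite (negPf iB); case: (i \in _) => /=; lra.
  by rewrite ji /= in ju; rewrite ju; case: (j \in _) => /=; lra.
move=> tP tP' tE; rewrite [t]surjective_pairing [t']surjective_pairing tE.
congr pair; apply/eqP; rewrite finset.eqEsubset.
by rewrite !sub // tE.
Qed.

(** The summand 1 keeps the factor defined at c = 0 and makes the total weight strictly less than 1,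
    as [cone_cover] needs. *)
Lemma scale_into_cube c : (forall i, 0 <= c 0 i) ->
  let e := (1 + \sum_i c 0 i)^-1 in
  [/\ 0 < e, forall i, 0 <= (e *: c) 0 i <= 1 & \sum_i (e *: c) 0 i < 1].
Proof.
move=> c0; have s0 : 0 <= \sum_i c 0 i by apply: sumr_ge0.
have N0 : 0 < 1 + \sum_i c 0 i by rewrite ltr_pwDl.
split=> [|i|]; first by rewrite invr_gt0.
  rewrite mxE mulr_ge0 ?invr_ge0 ?(ltW N0) //= mulrC ler_pdivrMr // mul1r.
  by rewrite (bigD1 i) //= addrCA lerDl addr_ge0 // sumr_ge0.
rewrite (eq_bigr (fun i => (1 + \sum_i c 0 i)^-1 * c 0 i)); last first.
  by move=> i _; rewrite mxE.
by rewrite -mulr_sumr mulrC ltr_pdivrMr // mul1r ltrDr.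
Qed.

(** Scale [p] to weight less than 1 and take a tile of the section on [S] there. A coordinate equal
    to 1 would already exceed this weight, so the tile has no index of [S] in its first
    component. *)
Lemma cone_cover S p : spans V S -> cone S p ->
  exists t, [/\ t \in P, t.2 \subset S, [disjoint t.1 & S]%B & cone t.2 p].
Proof.
move=> sp [c [cS c0 <-]]; have [e0 c01 c1] := scale_into_cube c0.
set e := _^-1 in e0 c01 c1; have gS := has_section_spans sp.
have [|t tP ct] := proj1 gS ((e *: c) *m V).
  by exists (e *: c); split=> //; exact: supportedZ.
have [tP' tS bt _] := tiles_onP P_tiles tP.
have [y cy yE] : exists2 y, cube (restr S t) y & y *m V = (e *: c) *m V.
  by eexists; [exact: ct | exact: coordsK].
have dt : [disjoint t.1 & S]%B.
  rewrite -setI_eq0; apply/eqP/finset.setP => i; rewrite finset.in_set0.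
  apply: contraTF c1 => it; rewrite -leNgt -weightE -yE weightE.
  rewrite (bigD1 i) //= (@cube1 _ _ (restr S t) y) // lerDl.
  by apply: sumr_ge0 => j _; have /andP[] := cube01 cy j.
exists t; split=> //; exists (e^-1 *: y); split.
- apply: supportedZ => i it; apply: (cube0 cy) => //.
  by rewrite disjoint_res //= finset.in_set0.
- move=> i; rewrite mxE; have /andP[y0 _] := cube01 cy i.
  by apply: mulr_ge0 => //; rewrite invr_ge0 ltW.
- by rewrite -scalemxAl yE -scalemxAl scalerA mulVf ?scale1r // gt_eqF.
Qed.

(** Scaled by a common factor, taken from [c + c'], both representations become lifts of one point
    and hence coincide. Positivity of [c] gives equal second components, and [basis_label]
    concludes. *)
Lemma cone_interior_label S t t' c : t \in P -> t' \in P ->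
  t.2 \subset S -> t'.2 \subset S ->
  [disjoint t.1 & S]%B -> [disjoint t'.1 & S]%B ->
  supported t.2 c -> (forall i, i \in t.2 -> 0 < c 0 i) ->
  cone t'.2 (c *m V) -> t = t'.
Proof.
move=> tP tP' tS tS' dt dt' ct cpos [c' [ct' c0' cE]].
have [_ bt] := P_tiles tP; have [_ bt'] := P_tiles tP'.
have gS := has_section_spans (basis_spans bt tS).
have c0 i : 0 <= c 0 i.
  by case: (boolP (i \in t.2)) => [/cpos/ltW//|it]; rewrite ct.
have cc0 i : 0 <= (c + c') 0 i by rewrite mxE addr_ge0.
have [e0 ec _] := scale_into_cube cc0.
set e := _^-1 in e0 ec.
have uS : t \in tiles_on P S by rewrite inE tP.
have uS' : t' \in tiles_on P S by rewrite inE tP'.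
have ecE (b : 'rV[R]_n) : (forall i, 0 <= b 0 i) -> (forall i, b 0 i <= (c + c') 0 i) ->
    forall i, 0 <= (e *: b) 0 i <= 1.
  move=> b0 bc i; rewrite mxE mulr_ge0 ?(ltW e0) //=.
  have /andP[_] := ec i; apply: le_trans; rewrite mxE.
  by rewrite ler_wpM2l ?(ltW e0).
have q1 : cube (restr S t) (e *: c).
  apply: cube_disjoint => //; first exact: supportedZ.
  by apply: ecE => // i; rewrite mxE lerDl.
have q2 : cube (restr S t') (e *: c').
  apply: cube_disjoint => //; first exact: supportedZ.
  by apply: ecE => // i; rewrite mxE lerDr.
have := sect_cube P_tiles gS uS' q2; rewrite -scalemxAl cE scalemxAl.
rewrite (sect_cube P_tiles gS uS q1) => /scalerI; rewrite gt_eqF // => /(_ isT) cc.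
apply: basis_label => //; apply/eqP; rewrite eqEcard (proj1 bt) (proj1 bt') leqnn andbT.
apply/fintype.subsetP => i it; apply: contraT => it'.
by have := cpos i it; rewrite cc ct' // ltxx.
Qed.

Local Notation vertex K := (indicator K : 'rV[R]_n).

(** * Generic points of a cone *)

Lemma exists_annihilator C (w : 'rV[R]_m) : (#|C|.+1 < m)%N ->
  exists u : 'cV[R]_m,
    [/\ u != 0, forall j, j \in C -> (V *m u) j 0 = 0 & w *m u = 0].
Proof.
move=> Cm; pose N := col_mx (rowsub (@enum_val _ (mem C)) V) w.
have : kermx N^T != 0.
  rewrite kermx_eq0 /row_free neq_ltn; apply/orP; left.
  by apply: leq_ltn_trans Cm; rewrite (leq_trans (rank_leq_col _)) // addn1.
case/rowV0Pn => v /sub_kermxP vN v0.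
have : N *m v^T = 0 by rewrite -[N]trmxK -trmx_mul vN trmx0.
rewrite mul_col_mx => /eqP; rewrite col_mx_eq0 => /andP[/eqP N1 /eqP N2].
exists v^T; split=> // [|j jC].
  by apply: contra v0 => /eqP v0; rewrite -[v]trmxK v0 trmx0.
move/colP: N1 => /(_ (enum_rank_in jC j)).
by rewrite mul_rowsub_mx !mxE enum_rankK_in.
Qed.

Lemma exists_pos_nonroot (q : {poly R}) : q != 0 -> exists2 x, 0 < x & ~~ root q x.
Proof.
move=> q0; pose rs : seq R := [seq k.+1%:R | k <- iota 0 (size q)].
(* [rs] offers one candidate more than the degree of [q]. *)
have : ~~ all (root q) rs.
  have urs : uniq rs.
    by rewrite map_inj_uniq ?iota_uniq // => k l /eqP; rewrite eqr_nat => /eqP[].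
  by apply/negP => /(max_poly_roots q0)/(_ urs); rewrite size_map size_iota ltnn.
by case/allPn => x /mapP[k _ ->] kq; exists k.+1%:R; rewrite ?ltr0Sn.
Qed.

(* The coordinates of z are powers of one number tau, so each of the finitely
   many conditions excludes finitely many values of tau. *)
Lemma exists_generic B (w : 'rV[R]_m) : basis V B ->
  exists z : 'rV[R]_n, [/\ supported B z, forall j, j \in B -> 0 < z 0 j &
    forall C y (s : R), (#|C|.+1 < m)%N -> supported C y ->
      z *m V <> y *m V + s *: w].
Proof.
move=> bB.
have /choice[u uP] : forall C : {set 'I_n}, exists u : 'cV[R]_m, (#|C|.+1 < m)%N ->
    [/\ u != 0, forall j, j \in C -> (V *m u) j 0 = 0 & w *m u = 0].
  move=> C; have [Cm|_] := ltnP #|C|.+1 m; last by exists 0.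
  by have [u uP] := exists_annihilator w Cm; exists u.
(* The value of [q C] at tau is that of the linear form [u C] at [z *m V]. The form vanishes on [w]
   and on the span of C, and it is nonzero on some v_b because B is a basis; a tau that is not a
   root keeps [z *m V] out of that span. *)
pose q C := \sum_(b in B) ((V *m u C) b 0) *: 'X^b : {poly R}.
have q0 C : (#|C|.+1 < m)%N -> q C != 0.
  case/uP => + _ _; apply: contra => /eqP qC; apply/eqP/row_matrixP => k.
  rewrite row0 rowE -(dualK (delta_mx 0 k) bB) -mulmxA.
  apply/rowP => l; rewrite !ord1 [RHS]mxE mxE big1 // => b _.
  have [bb|bb] := boolP (b \in B); last by rewrite (supported_dual _ _ bb) mul0r.
  suff -> : (V *m u C) b 0 = 0 by rewrite mulr0.
  move/polyP: qC => /(_ b); rewrite coef0 coef_sum (bigD1 b) //=.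
  rewrite coefZ coefXn eqxx mulr1 big1 ?addr0 // => b' /andP[_ bb'].
  by rewrite -val_eqE eq_sym in bb'; rewrite coefZ coefXn (negPf bb') mulr0.
have [|tau tau0] := @exists_pos_nonroot (\prod_(C : {set 'I_n} | (#|C|.+1 < m)%N) q C).
  by apply/prodf_neq0 => C; exact: q0.
rewrite rootE horner_prod => /prodf_neq0 qtau.
pose z : 'rV[R]_n := \row_j (if j \in B then tau ^+ j else 0).
exists z; split=> [j jB|j jB|C y s Cm yC zE].
- by rewrite mxE (negPf jB).
- by rewrite mxE jB exprn_gt0.
have /negP := qtau C Cm; apply; have [_ uC wC] := uP C Cm.
suff -> : (q C).[tau] = (z *m V *m u C) 0 0.
  rewrite zE mulmxDl -scalemxAl wC scaler0 addr0 -mulmxA mxE big1 // => j _.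
  have [jC|/yC ->] := boolP (j \in C); last by rewrite mul0r.
  by rewrite uC // mulr0.
rewrite horner_sum -mulmxA mxE [RHS](bigID (mem B)) /= [X in _ = _ + X]big1 ?addr0.
  by apply: eq_bigr => b bB'; rewrite hornerZ hornerXn !mxE bB' mulrC.
by move=> b bB'; rewrite [z _ _]mxE (negPf bB') mul0r.
Qed.

(** * The fan of the tiles around a vertex *)

Lemma full_cover p : zonotope_on V [set: 'I_n]%SET p ->
  exists2 t, t \in P & cube t (coords V t p).
Proof.
move=> /(proj1 P_section)[t]; rewrite inE => /andP[tP _] ct; exists t; first exact: tP.
by move: ct; rewrite /in_cell /restr finset.setIT -surjective_pairing.
Qed.

Lemma full_unique t t' y y' : t \in P -> t' \in P -> cube t y -> cube t' y' ->
  y *m V = y' *m V -> y = y'.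
Proof.
have restrT u : restr [set: 'I_n] u = u.
  by rewrite /restr finset.setIT -surjective_pairing.
have onT u : u \in P -> u \in tiles_on P [set: 'I_n].
  by rewrite inE finset.subsetT andbT.
move=> /onT tP /onT tP' cy cy' yE.
rewrite -(sect_cube P_tiles P_section tP (y := y)) ?restrT // yE.
by rewrite (sect_cube P_tiles P_section tP') ?restrT.
Qed.

(* Directions pointing from the vertex v_K of the cube into the cube. *)
Definition inward K c := forall j, if j \in K then c 0 j <= 0 else 0 <= c 0 j.

Lemma cube_inward K t c (e : R) : t \in P -> cube t (vertex K) -> supported t.2 c ->
  inward K c -> 0 <= e -> (forall j, e * `|c 0 j| <= 1) ->
  cube t (vertex K + e *: c).
Proof.
move=> tP cK ct cin e0 ec; have [dt _] := P_tiles tP.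
have KE j : (vertex K) 0 j = (j \in K)%:R by rewrite mxE.
have fE j : (vertex K + e *: c) 0 j = (vertex K) 0 j + e * c 0 j by rewrite !mxE.
apply/forallP => j; rewrite fE.
case: ifP => jt; first by rewrite (cube1 cK) // ct ?mulr0 ?addr0 // (disjointFr dt).
case: ifP => jt2; last by rewrite (cube0 cK) ?ct ?jt ?jt2 // mulr0 addr0.
have := cin j; have := ec j; rewrite KE; case: (j \in K) => /= h1 h2.
  have := mulr_ge0_le0 e0 h2; rewrite ler0_norm // mulrN in h1; lra.
have := mulr_ge0 e0 h2; rewrite ger0_norm // in h1; lra.
Qed.

(** Small multiples of [c] and [c'], by one factor suited to both, stay in their cube faces when
    added to the vertex; there the section is single valued. *)
Lemma fan_unique K t t' c c' : t \in P -> t' \in P ->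
  cube t (vertex K) -> cube t' (vertex K) ->
  supported t.2 c -> supported t'.2 c' ->
  inward K c -> inward K c' -> c *m V = c' *m V -> c = c'.
Proof.
move=> tP tP' cK cK' ct ct' cin cin' cE.
pose b : 'rV[R]_n := \row_j (`|c 0 j| + `|c' 0 j|).
have bE j : b 0 j = `|c 0 j| + `|c' 0 j| by rewrite mxE.
have [|e0 eb _] := @scale_into_cube b; first by move=> j; rewrite bE addr_ge0.
set e := _^-1 in e0 eb.
have eb' j : e * b 0 j <= 1 by have /andP[] := eb j; rewrite mxE.
have e1 j : e * `|c 0 j| <= 1.
  by apply: le_trans (eb' j); rewrite ler_wpM2l ?(ltW e0) // bE lerDl.
have e1' j : e * `|c' 0 j| <= 1.
  by apply: le_trans (eb' j); rewrite ler_wpM2l ?(ltW e0) // bE lerDr.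
have := full_unique tP tP' (cube_inward tP cK ct cin (ltW e0) e1)
  (cube_inward tP' cK' ct' cin' (ltW e0) e1').
rewrite !mulmxDl -!scalemxAl cE => /(_ erefl)/addrI/scalerI.
by apply; rewrite gt_eqF.
Qed.

Lemma fan_cover t0 c : t0 \in P -> inward t0.1 c ->
  exists t, [/\ t \in P, cube t (vertex t0.1) &
                inward t0.1 (c *m V *m dual_basis V t.2)].
Proof.
move=> t0P cin; set K := t0.1 in cin *; pose vK := (vertex K) *m V.
have KE j : (vertex K) 0 j = (j \in K)%:R by rewrite mxE.
have fE (s : R) y j : (vertex K + s *: y) 0 j = (j \in K)%:R + s * y 0 j.
  by rewrite !mxE.
pose b : 'rV[R]_n := \row_j `|c 0 j|.
have [|e0 eb _] := @scale_into_cube b; first by move=> j; rewrite mxE.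
set e := _^-1 in e0 eb.
have ec j : e * `|c 0 j| <= 1 by have /andP[] := eb j; rewrite !mxE.
pose A t := [set s : R | cube t (coords V t (vK + s *: (c *m V)))].
(* Tiles met at some positive [s] only: the tile found at s = 0 then contains v_K together with a
   second point of the ray, and their difference is the inward direction sought. *)
pose ts := [seq t <- enum P | `[< exists2 s, 0 < s <= e & A t s >]].
have [|||t] := @closed_cover_left _ _ A ts 0 e.
- exact: e0.
- by move=> t _; exact: closed_cube.
- move=> s /andP[s0 se].
  have [|t tP ct] := full_cover (p := vK + s *: (c *m V)).
    exists (vertex K + s *: c); split; first by move=> j; rewrite finset.in_setT.
      move=> j; rewrite fE.
      have sc : s * `|c 0 j| <= 1 by apply: le_trans (ec j); rewrite ler_wpM2r.
      have := cin j; case: (j \in K) => /= cj.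
        by have := mulr_ge0_le0 (ltW s0) cj; rewrite ler0_norm // mulrN in sc; lra.
      by have := mulr_ge0 (ltW s0) cj; rewrite ger0_norm // in sc; lra.
    by rewrite mulmxDl -scalemxAl.
  exists t => //; rewrite mem_filter mem_enum tP andbT; apply/asboolP.
  by exists s; rewrite ?s0.
rewrite mem_filter mem_enum => /andP[/asboolP[s /andP[s0 _] ct] tP].
rewrite /A /= scale0r addr0 => ctK.
have [dt bt] := P_tiles tP.
have cK0 : cube t0 (vertex K).
  apply/forallP => j; rewrite KE -/K.
  by case: (j \in K) => //=; case: (j \in t0.2); rewrite ?lexx ?ler01.
have lK : coords V t vK = vertex K by apply: (full_unique tP t0P) => //; exact: coordsK.
exists t; split=> //; first by rewrite -lK.
move=> j; move: (cube01 ct j); rewrite coords_line lK.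
rewrite fE.
move: (c *m V *m dual_basis V t.2) => z; case: (j \in K) => /= /andP[h1 h2].
  by rewrite -(pmulr_rle0 _ s0); lra.
by rewrite -(pmulr_rge0 _ s0); lra.
Qed.

Lemma closed_inward K y y' : closed [set s : R | inward K (y + s *: y')].
Proof.
pose F j := if j \in K then [set s : R | 0 <= - y 0 j + s * - y' 0 j]
            else [set s : R | 0 <= y 0 j + s * y' 0 j].
rewrite (_ : [set _ | _] = \bigcap_j F j).
  by apply: closed_bigI => j _; rewrite /F; case: ifP => _; exact: closed_affine_ge0.
have fE (s : R) j : (y + s *: y') 0 j = y 0 j + s * y' 0 j by rewrite !mxE.
apply/seteqP; split=> s /= h j; move: (h j); rewrite /F fE.
  by case: ifP => _ /=; lra.
by move=> /(_ Logic.I); case: ifP => _ /=; lra.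
Qed.

(* With K = t0.1, walk along a generic segment from a direction inside t0 to
   the direction -v_K, through the fan of the tiles at the vertex v_K. By
   genericity the wall through which the segment leaves the tiles with bottom
   vertex v_K has at least m - 1 generators, so that the tile behind it has a
   single downward generator -v_b. *)
Lemma exists_lower_tile t0 : t0 \in P -> t0.1 != finset.set0 ->
  exists b t, [/\ b \in t0.1, t \in P, t.1 = (t0.1 :\ b)%SET & b \in t.2].
Proof.
move=> t0P K0; set K := t0.1 in K0 *; apply: contrapT => noD.
have {}noD b t : b \in K -> t \in P -> t.1 = (K :\ b)%SET -> b \in t.2 -> False.
  by move=> bK tP tE bt; apply: noD; exists b, t.
have [dt0 bt0] := P_tiles t0P.
pose vK := (vertex K) *m V.
have [z [zB zpos zgen]] := exists_generic vK bt0.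
pose u (r : R) := z *m V + r *: - (z *m V + vK).
pose th (r : R) := z + r *: - (z + vertex K).
have uE r : th r *m V = u r.
  by rewrite /th /u mulmxDl -scalemxAl mulNmx mulmxDl.
have u1 : u 1 = - vK by rewrite /u scale1r opprD addrA subrr add0r.
have thin r : 0 <= r <= 1 -> inward K (th r).
  move=> /andP[r0 r1] j.
  have -> : th r 0 j = (1 - r) * z 0 j - r * (j \in K)%:R by rewrite !mxE; ring.
  case: (boolP (j \in K)) => jK /=; first by rewrite zB ?(disjointFr dt0) //; lra.
  rewrite mulr0 subr0 mulr_ge0 //; first by lra.
  by case: (boolP (j \in t0.2)) => [/zpos/ltW //|/zB ->].
(* A nonnegative combination of the v_j has nonnegative height, whereas [- vK] has height -|K| <
   0. *)
have last c : (forall j, 0 <= c 0 j) -> c *m V = u 1 -> False.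
  move=> c0 cE; have := weightE c; rewrite cE u1 mulNmx mxE weightE.
  have /set0Pn[k kK] := K0; rewrite (bigD1 k) //= mxE kK.
  have s1 : 0 <= \sum_(j < n | j != k) (vertex K) 0 j.
    by apply: sumr_ge0 => j _; rewrite mxE ler0n.
  have s2 : 0 <= \sum_j c 0 j by apply: sumr_ge0.
  move=> /= sE; rewrite -sE in s2.
  by have := ltr_wpDr s1 ltr01; rewrite ltNge -oppr_ge0 s2.
have flat t : cube t (vertex K) -> t.1 \subset K /\ K \subset t.1 :|: t.2.
  move=> ct; split; apply/fintype.subsetP => j.
    move=> /(cube1 ct)/eqP; rewrite mxE; case: (j \in K) => //.
    by rewrite eq_sym oner_eq0.
  move=> jK; rewrite inE; apply: contraT; rewrite negb_or => /andP[j1 j2].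
  by have /eqP := cube0 ct j1 j2; rewrite mxE jK oner_eq0.
(* [h r] says that [u r] is reached inside the fan without any downward generator. It holds at 0 and
   fails at 1. *)
pose h r := exists t c, [/\ t \in P, cube t (vertex K), supported t.2 c,
  inward K c /\ (forall j, 0 <= c 0 j) & c *m V = u r].
have nh1 : ~ h 1 by case=> t [c [_ _ _ [_ c0] cE]]; exact: (last c).
have h0 : h 0.
  exists t0, z; split=> //; last by rewrite /u scale0r addr0.
    apply/forallP => j; rewrite mxE -/K.
    by case: (j \in K) => //=; case: (j \in t0.2); rewrite ?lexx ?ler01.
  have z0 j : 0 <= z 0 j by case: (boolP (j \in t0.2)) => [/zpos/ltW //|/zB ->].
  split=> // j; case: ifP => // jK; rewrite zB //.
  by rewrite (disjointFr dt0).
apply: nh1; move: h0.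
pose ts := [seq t <- enum P | cube t (vertex K)].
apply: (@closed_cover_chain _ _
          (fun t => [set r | inward K (u r *m dual_basis V t.2)]) ts
          (fun r r' => h r -> h r')).
- exact: ler01.
- by move=> r1 r2 r3 h12 h23 /h12.
- move=> t _; rewrite (_ : [set _ | _] = [set r : R | inward K
    (z *m V *m dual_basis V t.2 + r *: (- (z *m V + vK) *m dual_basis V t.2))]).
    exact: closed_inward.
  by apply/seteqP; split=> r /=; rewrite /u mulmxDl -scalemxAl.
- move=> r r01; have [t [tP ct cin]] := fan_cover t0P (thin r r01).
  by exists t; [rewrite mem_filter ct mem_enum | rewrite /= -uE].
move=> t r r'; rewrite mem_filter mem_enum => /andP[ct tP] r0 rr' r1 Ar Ar'.
case=> t' [c [tP' ct' c_supp [cin c0] cE]].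
have [dt bt] := P_tiles tP; have [tK Kt] := flat _ ct.
have bE : u r *m dual_basis V t.2 = c.
  apply: (fan_unique tP tP' ct ct') => //; first exact: supported_dual.
  by rewrite dualK.
have [K1|/fintype.subsetPn[b bK bt1]] := boolP (K \subset t.1).
  have tE : t.1 = K by apply/eqP; rewrite finset.eqEsubset tK K1.
  exists t, (u r' *m dual_basis V t.2).
  split=> //; [exact: supported_dual| |exact: dualK].
  split=> // j; have := Ar' j; case: ifP => // jK _.
  by rewrite supported_dual // (disjointFr dt) // tE.
have bt2 : b \in t.2.
  by move/fintype.subsetP: Kt => /(_ b bK); rewrite inE (negPf bt1).
have [Kb|/fintype.subsetPn[b']] := boolP (K :\ b \subset t.1)%SET.
  case: (noD b t) => //; apply/eqP; rewrite finset.eqEsubset Kb andbT.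
  by rewrite finset.subsetD1 tK.
rewrite !inE => /andP[b'b b'K] b't1.
have b't2 : b' \in t.2.
  by move/fintype.subsetP: Kt => /(_ b' b'K); rewrite inE (negPf b't1).
have cardC : (#|t.2 :\: K|.+1 < m)%N.
  rewrite -(proj1 bt) -(cardsID K t.2) -add2n leq_add2r.
  apply: (@leq_trans #|[set b'; b]|%SET); first by rewrite cards2 b'b.
  apply: subset_leq_card; apply/fintype.subsetP => k; rewrite !inE.
  by case/orP => /eqP ->; apply/andP.
have cC : supported (t.2 :\: K)%SET c.
  move=> j; rewrite !inE negb_and negbK => /orP[jK|jt].
    by apply: le_anti; rewrite c0 andbT; have := cin j; rewrite jK.
  by rewrite -bE supported_dual.
have rlt1 : r < 1.
  rewrite lt_neqAle (le_trans rr' r1) andbT; apply/eqP => rE.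
  by apply: (last c) => //; rewrite -rE.
(* Being inward and nonnegative, [c] vanishes on K, and [b], [b'] leave at most m - 2 generators
   outside K. Solving [u r = c *m V] for [z *m V], with r < 1, contradicts genericity. *)
case: (zgen _ ((1 - r)^-1 *: c) (r / (1 - r)) cardC); first exact: supportedZ.
have r1' : 1 - r != 0 by rewrite subr_eq0 gt_eqF.
apply: (scalerI r1'); rewrite scalerDr -scalemxAl !scalerA mulfV // scale1r cE.
rewrite [_ * (r / _)]mulrC divfK // /u scalerN scalerDr scalerBl scale1r.
by rewrite opprD addrA subrK.
Qed.

End CausalConfiguration.

(** * Link regions and the procedure *)

Section PointConfiguration.
Context {R : realType} {d n : nat} (a : 'I_n -> 'rV[R]_d).
Local Notation label := ({set 'I_n} * {set 'I_n})%type.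
Implicit Types (S B I K Q : {set 'I_n}) (i j : 'I_n) (t : label).
Implicit Types (y c : 'rV[R]_n) (x w : 'rV[R]_d) (p : 'rV[R]_(d + 1)).

Definition lift_mx : 'M[R]_(n, d + 1) := \matrix_i lift_vec a i.
Definition height : 'cV[R]_(d + 1) := col_mx 0 1.
Definition homogenize x : 'rV[R]_(d + 1) := row_mx x (const_mx 1).
Local Notation V := lift_mx.

Lemma lift_mx_height : V *m height = const_mx 1.
Proof.
apply/row_matrixP => i; rewrite row_mul rowK /lift_vec mul_row_col mulmx0 add0r.
by rewrite mulmx1; apply/rowP => j; rewrite !mxE.
Qed.

Lemma mul_lift_mx y : y *m V = \sum_i y 0 i *: lift_vec a i.
Proof. by rewrite mulmx_sum_row; apply: eq_bigr => i _; rewrite rowK. Qed.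

Lemma row_lift_sum y :
  y *m V = row_mx (\sum_i y 0 i *: a i) (const_mx (\sum_i y 0 i)).
Proof.
rewrite mul_lift_mx; apply/rowP => k; rewrite summxE -(fintype.splitK k).
case: (fintype.split k) => j /=; rewrite ?row_mxEl ?row_mxEr.
  by rewrite summxE; apply: eq_bigr => i _; rewrite mxE row_mxEl !mxE.
by rewrite mxE; apply: eq_bigr => i _; rewrite mxE row_mxEr mxE mulr1.
Qed.

Lemma sum_supported (T : nmodType) (F : 'I_n -> R -> T) S y : supported S y ->
  (forall i, F i 0 = 0) -> \sum_i F i (y 0 i) = \sum_(i in S) F i (y 0 i).
Proof.
move=> yS F0; rewrite [RHS]big_mkcond; apply: eq_bigr => i _.
by case: ifPn => // /yS ->.
Qed.

Lemma row_supported_sum S y : supported S y ->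
  y *m V = row_mx (\sum_(i in S) y 0 i *: a i) (const_mx (\sum_(i in S) y 0 i)).
Proof.
move=> yS; rewrite row_lift_sum (sum_supported (F := fun i s => s *: a i) yS).
  by rewrite (sum_supported (F := fun i s => s) yS).
by move=> i; exact: scale0r.
Qed.

(** The hull is the slice at height 1 of the cone over the lifted points. *)
Lemma hullP S x : hull a S x <-> cone V S (homogenize x).
Proof.
split=> [[c [c0 c1 ->]]|[c [cS c0]]].
  pose y : 'rV[R]_n := \row_i if i \in S then c i else 0.
  have yE i : i \in S -> y 0 i = c i by rewrite mxE => ->.
  have yS : supported S y by move=> i iS; rewrite mxE (negPf iS).
  exists y; split=> // [i|]; first by rewrite mxE; case: ifP => // /c0.
  rewrite (row_supported_sum yS); congr row_mx; first by apply: eq_bigr => i /yE ->.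
  by rewrite (eq_bigr c) ?c1 // => i /yE.
rewrite (row_supported_sum cS) => /eq_row_mx[xE /matrixP/(_ 0 0)]; rewrite !mxE => sE.
by exists (fun i => c 0 i).
Qed.

Lemma basis_tile t : is_tile a t -> [disjoint t.1 & t.2]%B /\ basis V t.2.
Proof.
case=> dt ct it; split=> //; split=> [|y yt]; first by rewrite ct addn1.
rewrite (row_supported_sum yt) -(@row_mx0 _ 1 d 1) => /eq_row_mx[s0 /matrixP/(_ 0 0)].
rewrite !mxE => s1; apply/rowP => i; rewrite mxE.
have [i2|/yt//] := boolP (i \in t.2).
exact: (it (fun i => y 0 i)).
Qed.

Lemma spanning_lift : affinely_spanning a -> spans V [set: 'I_n]%SET.
Proof.
move=> spa p; have [c [c1 cE]] := spa (lsubmx p); have [e [e1 eE]] := spa 0.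
(* [e] has total weight 1 and represents the point 0, so adding [s] copies of it corrects the weight
   without moving the point. *)
pose s := rsubmx p 0 0 - 1.
exists (\row_i (c i + s * e i)); first by move=> i; rewrite inE.
rewrite row_lift_sum -[p]hsubmxK; congr row_mx.
  have -> : lsubmx p = \sum_i c i *: a i + s *: (\sum_i e i *: a i).
    by rewrite -eE scaler0 addr0.
  rewrite scaler_sumr -big_split /=.
  by apply: eq_bigr => i _; rewrite mxE scalerDl scalerA.
apply/rowP => j; rewrite !ord1 [LHS]mxE.
rewrite (eq_bigr (fun i => c i + s * e i)); last by move=> i _; rewrite mxE.
by rewrite big_split /= -mulr_sumr c1 e1 mulr1 /s addrC subrK.
Qed.

(** * From tilings to sections *)

Lemma cellP t p : [disjoint t.1 & t.2]%B ->
  cell a t p <-> exists2 y, cube t y & y *m V = p.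
Proof.
move=> dt; have sumE y : cube t y -> y *m V =
    \sum_(i in t.1) lift_vec a i + \sum_(b in t.2) y 0 b *: lift_vec a b.
  move=> cy; rewrite mul_lift_mx (bigID (mem t.1)) /=; congr (_ + _).
    by apply: eq_bigr => i it; rewrite (cube1 cy) // scale1r.
  rewrite (bigID (mem t.2)) /= [X in _ + X]big1 ?addr0; last first.
    by move=> i /andP[i1 i2]; rewrite (cube0 cy) // scale0r.
  apply: eq_bigl => i; case: (boolP (i \in t.2)) => i2; rewrite ?andbF ?andbT //.
  by rewrite (disjointFl dt).
split=> [[c [c01 ->]]|[y cy <-]]; last first.
  exists (fun i => y 0 i); split=> [b bt|]; last exact: sumE.
  exact: (cube01 cy).
pose y : 'rV[R]_n := \row_i if i \in t.1 then 1 else if i \in t.2 then c i else 0.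
have cy : cube t y.
  apply/forallP => i; rewrite mxE; case: (i \in t.1); rewrite ?eqxx //.
  by case: (boolP (i \in t.2)) => [/c01|_]; rewrite ?eqxx.
exists y => //; rewrite sumE //; congr (_ + _); apply: eq_bigr => i it.
by rewrite mxE it (disjointFl dt).
Qed.

Lemma cube_face f t y : face_of f t -> [disjoint t.1 & t.2]%B -> cube f y -> cube t y.
Proof.
case/and3P => /fintype.subsetP f2 /fintype.subsetP f1 /fintype.subsetP f12 dt cy.
apply/forallP => i; case: ifP => i1; first by rewrite (cube1 cy) ?f1.
case: ifP => i2; first exact: (cube01 cy).
rewrite (cube0 cy) //; last by apply: contraFN i2 => /f2.
by apply/negP => /f12; rewrite !inE i1 i2 andbF.
Qed.

Lemma face_disjoint f t : face_of f t -> [disjoint t.1 & t.2]%B ->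
  [disjoint f.1 & f.2]%B.
Proof.
case/and3P => /fintype.subsetP f2 _ /fintype.subsetP f12 dt.
rewrite -setI_eq0; apply/eqP/finset.setP => i; rewrite finset.in_set0 inE.
apply/negP => /andP[/f12]; rewrite !inE => /orP[i1 /f2|/andP[/negPf ->]//].
by rewrite (disjointFr dt).
Qed.

Context (P : {set label}).
Context (P_tiling : fine_zonotopal_tiling a P).

Lemma tiling_tiles t : t \in P -> [disjoint t.1 & t.2]%B /\ basis V t.2.
Proof. by case: P_tiling => tP _ _ _ /tP; exact: basis_tile. Qed.

(** Since the common face has one label in both tiles, a lift [z] of [p] in that face is the lift in
    each of them. *)
Lemma tiling_faces s t p y y' : s \in P -> t \in P ->
  cube s y -> y *m V = p -> cube t y' -> y' *m V = p ->
  exists f z, [/\ face_of f s, face_of f t, cube f z, z = y /\ z = y' &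
                  cell a s `&` cell a t = cell a f].
Proof.
move=> sP tP cs yE ct y'E; have [ds bs] := tiling_tiles sP.
have [dt bt] := tiling_tiles tP.
have cp : (cell a s `&` cell a t) p by split; apply/cellP => //; [exists y|exists y'].
have [_ _ _ /(_ s t sP tP)[st0|[f [fs ft st]]]] := P_tiling.
  by rewrite st0 in cp.
have [z cz zE] : exists2 z, cube f z & z *m V = p.
  by apply/cellP; [exact: face_disjoint fs ds | rewrite -st].
exists f, z; split=> //; split.
  by rewrite -(cube_coords bs (cube_face fs ds cz)) zE -yE cube_coords.
by rewrite -(cube_coords bt (cube_face ft dt cz)) zE -y'E cube_coords.
Qed.

Lemma tiling_has_section : has_section V P [set: 'I_n]%SET.
Proof.
have restrT t : restr [set: 'I_n]%SET t = t.
  by rewrite /restr finset.setIT -surjective_pairing.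
have onT t : (t \in tiles_on P [set: 'I_n]%SET) = (t \in P).
  by rewrite inE finset.subsetT andbT.
split=> [p [x [_ x01 xE]]|p s t].
  have [_ cov _ _] := P_tiling.
  have : zonotope a p.
    by exists (fun i => x 0 i); split=> //; rewrite -mul_lift_mx.
  rewrite -cov => -[t /= tP]; have [dt bt] := tiling_tiles tP.
  move/(cellP _ dt) => [y cy <-]; exists t; rewrite ?onT //.
  by apply: (cube_in_cell tiling_tiles); rewrite ?onT ?restrT.
rewrite !onT /in_cell !restrT => sP tP cs ct.
have [ds bs] := tiling_tiles sP; have [dt bt] := tiling_tiles tP.
by have [f [z [_ _ _ [<- <-] _]]] := tiling_faces sP tP cs (coordsK p bs) ct (coordsK p bt).
Qed.

(* Cutting the tiles with bottom vertex v_I at height |I| + 1 reveals the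
   simplices of the triangulation. *)
Lemma simplices_meet_in_face I B B' : (I, B) \in P -> (I, B') \in P ->
  exists C : {set 'I_n}, [/\ C \subset B, C \subset B' &
    hull a B `&` hull a B' = hull a C].
Proof.
move=> sP tP; have [ds bs] := tiling_tiles sP; have [dt bt] := tiling_tiles tP.
have cI B0 : [disjoint I & B0]%B ->
    forall c, supported B0 c -> (forall i, 0 <= c 0 i) ->
    \sum_i c 0 i = 1 -> cube (I, B0) (indicator I + c).
  move=> d0 c cB c0 c1; apply/forallP => i /=; rewrite !mxE.
  case: (boolP (i \in I)) => iI /=; first by rewrite cB ?addr0 ?(disjointFr d0).
  rewrite add0r; case: ifPn => iB; last by rewrite cB.
  by rewrite c0 -c1 (bigD1 i) //= lerDl sumr_ge0.
have c0I B0 : cube (I, B0) (indicator I : 'rV[R]_n).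
  apply/forallP => i /=; rewrite mxE; case: (i \in I) => //=.
  by case: (i \in B0); rewrite ?mulr0n ?eqxx ?lexx ?ler01.
have [[J C] [z [fs ft cz [zE _] stE]]] :=
  tiling_faces sP tP (c0I B) (erefl _) (c0I B') (erefl _).
(* The face contains v_I, and the lift of v_I is the indicator of I; its coordinates indexed by J
   equal 1. *)
have JI : J = I.
  case/and3P: fs => /= _ IJ _; apply/eqP; rewrite finset.eqEsubset IJ andbT.
  apply/fintype.subsetP => j jJ; have /eqP := cube1 cz jJ; rewrite zE mxE.
  by case: (j \in I) => //=; rewrite eq_sym oner_eq0.
subst J; have dC := face_disjoint fs ds.
case/and3P: (fs) => /= CB _ _; case/and3P: (ft) => /= CB' _ _.
exists C; split=> //; apply/seteqP; split=> x; last first.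
  by move=> /hullP xC; split; apply/hullP; exact: coneS xC.
have sumx c : c *m V = homogenize x -> \sum_i c 0 i = 1.
  by rewrite row_lift_sum => /eq_row_mx[_ /matrixP/(_ 0 0)]; rewrite !mxE.
move=> [/hullP[c [cB c0 cE]] /hullP[c' [cB' c0' cE']]].
have : (cell a (I, B) `&` cell a (I, B')) ((indicator I + c) *m V).
  split; apply/cellP => //.
    by exists (indicator I + c) => //; apply: cI => //; exact: sumx cE.
  exists (indicator I + c'); first by apply: cI => //; exact: sumx cE'.
  by rewrite !mulmxDl cE cE'.
rewrite stE => /(cellP _ dC)[y cy].
have cyB := cube_face fs ds cy => yE.
have : y = indicator I + c.
  rewrite -(cube_coords bs cyB) yE cube_coords //; apply: cI => //; exact: sumx cE.
move=> {}yE; apply/hullP; exists c; split=> // i iC.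
have [iI|iI] := boolP (i \in I); first by rewrite cB // (disjointFr ds).
by have := cube0 cy iI iC; rewrite yE !mxE (negPf iI) add0r.
Qed.

(** * Barycentric coordinates and open simplices *)

Definition bary B x : 'rV[R]_n := homogenize x *m dual_basis V B.

Lemma hull_bary B x : basis V B -> hull a B x <-> forall i, 0 <= bary B x 0 i.
Proof. by move=> bB; rewrite hullP cone_basis. Qed.

Lemma bary_line B x w (s : R) i :
  bary B (x + s *: (w - x)) 0 i = (1 - s) * bary B x 0 i + s * bary B w 0 i.
Proof.
have -> : bary B (x + s *: (w - x)) = (1 - s) *: bary B x + s *: bary B w.
  rewrite /bary !scalemxAl -mulmxDl; congr (_ *m _).
  rewrite /homogenize !scale_row_mx add_row_mx; congr row_mx.
    by rewrite scalerBr scalerBl scale1r addrA addrAC.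
  by apply/rowP => k; rewrite !mxE !mulr1 subrK.
by rewrite !mxE.
Qed.

Lemma continuous_bary B i : continuous (fun x => bary B x 0 i).
Proof.
rewrite /bary; move: (dual_basis V B) => D.
have -> : (fun x => (homogenize x *m D) 0 i) = (fun x : 'rV[R]_d =>
    (\sum_(j < d) x 0 j * usubmx D j i) + dsubmx D 0 i).
  apply/funext => x; rewrite /homogenize -[D in LHS]vsubmxK mul_row_col.
  by rewrite !mxE big_ord1 !mxE mul1r.
have cS : continuous (fun x : 'rV[R]_d => \sum_(j < d) x 0 j * usubmx D j i).
  apply: (@continuous_big R 'I_d +%R 0 xpredT) => [|j _ x]; first exact: add_continuous.
  apply: (@cvgM R _ (nbhs x)); first exact: coord_continuous.
  exact: (@cvg_cst _ _ _ (nbhs x)).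
move=> x; apply: (@cvgD R R _ (nbhs x)); first exact: cS.
exact: (@cvg_cst _ _ _ (nbhs x)).
Qed.

Lemma closed_hull B : basis V B -> closed (hull a B).
Proof.
move=> bB; have -> : hull a B = \bigcap_i [set x | 0 <= bary B x 0 i].
  apply/seteqP; split=> x; first by move/(hull_bary _ bB) => h i _; exact: h.
  by move=> h; apply/hull_bary => // i; exact: h.
apply: closed_bigI => i _.
apply: (@preimage_closed _ _ (fun x => bary B x 0 i) [set r | 0 <= r]).
  by move=> x _; exact: continuous_bary.
exact: closed_ge.
Qed.

Definition open_simplex B : set 'rV[R]_d :=
  [set x | forall i, i \in B -> 0 < bary B x 0 i].

Lemma open_open_simplex B : open (open_simplex B).
Proof.
have -> : open_simplex B =
    ~` \bigcup_(i in [set` B]) [set x | bary B x 0 i <= 0].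
  apply/seteqP; split=> x.
    by move=> h [i /= /h]; rewrite ltNge => /negP.
  move=> h i iB; rewrite ltNge; apply/negP => hi; apply: h.
  by exists i.
apply: closed_openC; apply: closed_bigcup => // i _.
apply: (@preimage_closed _ _ (fun x => bary B x 0 i) [set r | r <= 0]).
  by move=> x _; exact: continuous_bary.
exact: closed_le.
Qed.

Lemma open_simplex_hull B : basis V B -> open_simplex B `<=` hull a B.
Proof.
move=> bB x xB; apply/hull_bary => // i.
have [/xB/ltW//|iB] := boolP (i \in B).
by rewrite /bary (supported_dual _ _ iB).
Qed.

Lemma open_simplex_nonempty B : basis V B -> open_simplex B !=set0.
Proof.
move=> bB; have B0 : (0 < #|B|)%N by rewrite (proj1 bB) addn1.
have k0 : 0 < (#|B|%:R : R) by rewrite ltr0n.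
pose y : 'rV[R]_n := #|B|%:R^-1 *: indicator B.
have yB : supported B y by move=> i iB; rewrite !mxE (negPf iB) mulr0.
exists (\sum_i y 0 i *: a i) => i iB.
suff -> : bary B (\sum_i y 0 i *: a i) = y by rewrite !mxE iB mulr1 invr_gt0.
rewrite /bary -[RHS](dualVK bB yB); congr (_ *m _).
rewrite row_lift_sum; congr row_mx; congr const_mx.
rewrite (sum_supported (F := fun _ s => s) yB) //.
rewrite (eq_bigr (fun _ => #|B|%:R^-1)); last by move=> j jB; rewrite !mxE jB mulr1.
by rewrite sumr_const -[RHS]mulr_natr mulVf // gt_eqF.
Qed.

Lemma nbhs_line x w (U : set 'rV[R]_d) : nbhs x U ->
  exists s : R, [/\ 0 < s, s <= 1 & U (x + s *: w)].
Proof.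
case/nbhs_ballP => e /= e0 eU; pose N := 1 + \sum_k `|w 0 k|.
have N0 : 0 < N by rewrite ltr_pwDl // sumr_ge0.
have wN k : `|w 0 k| < N.
  by rewrite /N (bigD1 k) //= addrCA ltrDl ltr_pwDl // sumr_ge0.
have m0 : 0 < Num.min (e / N) 1 by rewrite lt_min divr_gt0 ?ltr01.
exists (Num.min (e / N) 1); split=> //; first by rewrite ge_min lexx orbT.
apply: eU; split=> // l k; rewrite ord1 /ball /= !mxE opprD addrA subrr sub0r normrN.
rewrite normrM gtr0_norm //; apply: le_lt_trans (_ : e / N * `|w 0 k| < _).
  by rewrite ler_wpM2r // ge_min lexx.
by rewrite mulrAC ltr_pdivrMr // ltr_pM2l.
Qed.

Lemma hull_closure_open_simplex B : basis V B -> hull a B `<=` closure (open_simplex B).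
Proof.
move=> bB x /(hull_bary _ bB) x0 U /(nbhs_line (_ - x)) xU.
have [g gB] := open_simplex_nonempty bB.
have [s [s0 s1 Us]] := xU g; exists (x + s *: (g - x)); split=> // i iB.
rewrite bary_line ltr_wpDl // ?mulr_ge0 ?subr_ge0 //.
by rewrite mulr_gt0 // gB.
Qed.

(** From an interior point one can step in any direction inside the hull. The difference of two
    representations, divided by the step, represents that direction; a multiple of the first adjusts
    the height. *)
Lemma interior_hull_spans S : interior (hull a S) !=set0 -> spans V S.
Proof.
case=> x xS p; have /hullP[c [cS _ cE]] := interior_subset xS.
pose s := rsubmx p 0 0; pose w := lsubmx p - s *: x.
have [e [e0 _ /hullP[c' [cS' _ cE']]]] := nbhs_line w xS.
exists (s *: c + e^-1 *: (c' - c)).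
  apply: supportedD; apply: supportedZ => //; apply: supportedD => //.
  by rewrite -scaleN1r; exact: supportedZ.
rewrite mulmxDl -!scalemxAl mulmxBl cE cE' /homogenize opp_row_mx add_row_mx.
rewrite !scale_row_mx add_row_mx -[RHS]hsubmxK; congr row_mx.
  by rewrite addrAC subrr add0r scalerA mulVf ?gt_eqF // scale1r /w addrC subrK.
by apply/rowP => k; rewrite !ord1 !mxE subrr mulr0 addr0 mulr1 /s mxE.
Qed.

(** * Link regions as regularized differences *)

Lemma link_tilesP r Q t :
  reflect [/\ t \in P, #|t.1| = r, [disjoint t.2 & Q]%B & t.1 \subset Q]
          (t \in link_tiles P r Q).
Proof.
rewrite !inE; apply: (iffP idP) => [/andP[/andP[tP /eqP tr] /andP[tQ QT]]|].
  by split.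
by case=> -> -> -> ->; rewrite eqxx.
Qed.

Lemma link_regionP Q x :
  link_region a P Q x <-> exists2 B, (Q, B) \in P & hull a B x.
Proof.
split=> [[t /= /link_tilesP[tP tQ _ sQ] tx]|[B QP Bx]].
  have tE : t.1 = Q by apply/eqP; rewrite eqEcard sQ tQ leqnn.
  by exists t.2 => //; rewrite -tE -surjective_pairing.
exists (Q, B) => //=; apply/link_tilesP; split=> //=.
by rewrite disjoint_sym; have [] := tiling_tiles QP.
Qed.

Lemma disjointC_subset S Q : [disjoint S & ~: Q]%B = (S \subset Q).
Proof. by rewrite finset.disjoints_subset finset.setCK. Qed.

(** [cone_cover] for the complement of Q yields a tile with I inside Q; comparing |I| with |Q|
    decides between the two cases. *)
Lemma hull_cover Q x : spans V (~: Q)%SET -> hull a (~: Q)%SET x ->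
  (exists r, (r < #|Q|)%N /\ link_union a P r Q x) \/ link_region a P Q x.
Proof.
move=> sp /hullP xQ.
have [t [tP t2 t1 /hullP tx]] :=
  cone_cover lift_mx_height tiling_tiles tiling_has_section sp xQ.
rewrite disjointC_subset in t1; rewrite -finset.disjoints_subset in t2.
have tl : t \in link_tiles P #|t.1| Q by apply/link_tilesP.
have := subset_leq_card t1; rewrite leq_eqVlt => /predU1P[tE|tE].
  by right; exists t; rewrite //= -tE.
by left; exists #|t.1|; split=> //; exists t.
Qed.

Lemma open_simplex_link Q B r : (Q, B) \in P -> (r < #|Q|)%N ->
  open_simplex B `<=` ~` link_union a P r Q.
Proof.
move=> QP rQ x xB [t /= /link_tilesP[tP tr tQ sQ] /hullP tx].
have [dB bB] := tiling_tiles QP; rewrite /= in dB bB.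
suff tE : (Q, B) = t by rewrite -tE /= in tr; rewrite tr ltnn in rQ.
apply: (cone_interior_label tiling_tiles tiling_has_section (S := (~: Q)%SET)
          (c := bary B x)) => //=; rewrite ?disjointC_subset //.
- by rewrite -finset.disjoints_subset disjoint_sym.
- by rewrite -finset.disjoints_subset.
- exact: supported_dual.
- by rewrite /bary dualK.
Qed.

Definition residual (H : {set label}) Q : set 'rV[R]_d :=
  hull a (~: Q)%SET `\` \bigcup_(r in `I_#|Q|) link_union a H r Q.

Lemma open_simplex_residual Q B : (Q, B) \in P ->
  open_simplex B `<=` interior (residual P Q).
Proof.
move=> QP; rewrite -open_subsetE; last exact: open_open_simplex.
have [dB bB] := tiling_tiles QP; rewrite /= in dB bB.
move=> x xB; split.
  apply/hullP; apply: coneS (iffLR (hullP _ _) (open_simplex_hull bB xB)).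
  by rewrite -finset.disjoints_subset disjoint_sym.
by case=> r /= rQ; apply: open_simplex_link xB.
Qed.

Lemma closed_link_region Q : closed (link_region a P Q).
Proof.
apply: closed_bigcup => // t /= /link_tilesP[tP _ _ _].
by apply: closed_hull; have [] := tiling_tiles tP.
Qed.

(** One inclusion rests on the link region being closed, the other on every simplex lying in the
    closure of its open simplex, which avoids all that is removed. *)
Lemma residual_regionE Q B : (Q, B) \in P ->
  residual_region a P #|Q| Q = link_region a P Q.
Proof.
move=> QP; have [dB bB] := tiling_tiles QP; rewrite /= in dB bB.
have sp : spans V (~: Q)%SET.
  by apply: basis_spans bB _; rewrite -finset.disjoints_subset disjoint_sym.
apply/seteqP; split=> x.
  rewrite [link_region _ _ _](iffLR (closure_id _) (@closed_link_region Q)).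
  apply: closureS => z /interior_subset[/(hull_cover sp)[[r [rQ zr]]|//]].
  by case; exists r.
move/link_regionP => [B' QP' Bx]; have [_ bB'] := tiling_tiles QP'.
apply: closureS (hull_closure_open_simplex bB' Bx).
exact: open_simplex_residual.
Qed.

(** From left to right, spanning of the complement of Q is not given; it is read off an interior
    point of the hull. *)
Lemma residual_region_nonempty Q :
  interior (residual_region a P #|Q| Q) !=set0 <-> exists B, (Q, B) \in P.
Proof.
split=> [[x /interior_subset xQ]|[B QP]].
  have [z zQ] : interior (residual P Q) !=set0.
    by have [z [zQ _]] := xQ setT filterT; exists z.
  have sp : spans V (~: Q)%SET.
    by apply: interior_hull_spans; exists z; apply: interiorS zQ => u [].
  have [zh zr] := interior_subset zQ.
  have [[r [rQ zl]]|/link_regionP[B QP _]] := hull_cover sp zh; last by exists B.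
  by case: zr; exists r.
have [_ bB] := tiling_tiles QP; have [g gB] := open_simplex_nonempty bB.
exists g; apply: interiorS; first exact: subset_closure.
rewrite (iffLR (interior_id _) (@open_interior _ _)).
exact: open_simplex_residual gB.
Qed.

(** * The run of the procedure *)

Definition label_triangulation I : {set {set 'I_n}} := [set B | (I, B) \in P]%SET.

Definition tiles_below k : {set label} := [set t in P | (#|t.1| < k)%N]%SET.

Definition labels_of_size k : {set {set 'I_n}} :=
  [set I : {set 'I_n} | (#|I| == k) && [exists B, (I, B) \in P]]%SET.

Local Notation T := label_triangulation.

Lemma residual_region_below k Q : residual_region a (tiles_below k) k Q = residual_region a P k Q.
Proof.
rewrite /residual_region; congr (closure (interior (_ `\` _))).
apply: eq_bigcupr => r /= rk; rewrite /link_union.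
suff -> : link_tiles (tiles_below k) r Q = link_tiles P r Q by [].
apply/finset.setP => t; rewrite !inE; case: eqP => [->|]; rewrite ?andbF //.
by rewrite rk andbT.
Qed.

Lemma new_tiles_labels k : new_tiles T (labels_of_size k) = level P k.
Proof.
apply/finset.setP => t; rewrite !inE -surjective_pairing.
apply/andP/andP => [[/andP[tk _] tP]//|[tP tk]]; split=> //; rewrite tk /=.
by apply/existsP; exists t.2; rewrite -surjective_pairing.
Qed.

Lemma labels_of_sizeP k I :
  reflect (#|I| = k /\ exists B, (I, B) \in P) (I \in labels_of_size k).
Proof.
rewrite inE; apply: (iffP andP) => [[/eqP Ik /existsP]|[-> IP]]; first by split.
by split=> //; apply/existsP.
Qed.

Lemma tiles_belowS k : (tiles_below k :|: level P k)%SET = tiles_below k.+1.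
Proof.
apply/finset.setP => t; rewrite !inE [in RHS]ltnS [in RHS]leq_eqVlt.
by rewrite -andb_orr orbC.
Qed.

Lemma tiles_below0 : tiles_below 0 = finset.set0.
Proof. by apply/finset.setP => t; rewrite !inE andbF. Qed.

Context (a_spanning : affinely_spanning a).

Lemma labels_of_size0 : labels_of_size 0 = [set finset.set0]%SET.
Proof.
apply/finset.setP => I; rewrite finset.in_set1.
apply/labels_of_sizeP/eqP => [[/cards0_eq]//|->].
rewrite cards0; split=> //.
have sp : spans V (~: finset.set0)%SET by rewrite finset.setC0; exact: spanning_lift.
have [c [c1 _]] := a_spanning 0.
have [i _|n0] := pickP 'I_n; last first.
  by rewrite big_pred0 // in c1; move/eqP: c1; rewrite eq_sym oner_eq0.
have ai : hull a (~: finset.set0)%SET (a i).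
  apply/hullP; exists (delta_mx 0 i); split.
  - by apply: supported_delta; rewrite finset.setC0 finset.in_setT.
  - by move=> j; rewrite mxE ler0n.
  - by rewrite -rowE rowK.
have [[r [+ _]]|/link_regionP[B]] := hull_cover sp ai; last by exists B.
by rewrite cards0.
Qed.

(** Soundness of the new index set comes from the nonemptiness test, completeness from
    [exists_lower_tile]. By [residual_region_below] the test gives the same answer with the
    constructed tiles as with all of [P]. *)
Lemma stateE k : state a T k = (labels_of_size k, tiles_below k).
Proof.
elim: k => [|k IHk] /=; first by rewrite labels_of_size0 tiles_below0.
rewrite IHk new_tiles_labels tiles_belowS; congr pair; apply/finset.setP => K.
rewrite inE; apply/andP/labels_of_sizeP => [[]|].
  case/existsP => t /andP[]; rewrite inE => /andP[tP /eqP tk].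
  case/existsP => b /andP[bt /eqP KE].
  have Kk : #|K| = k.+1.
    rewrite KE finset.setUC cardsU1 tk.
    by rewrite (disjointFl (proj1 (tiling_tiles tP)) bt).
  by move=> /asboolP; rewrite residual_region_below -Kk => /residual_region_nonempty.
case=> Kk [B KP]; split.
  have K0 : (K, B).1 != finset.set0 by rewrite -card_gt0 Kk.
  have [b [t [/= bK tP tE bt]]] :=
    exists_lower_tile lift_mx_height tiling_tiles tiling_has_section KP K0.
  apply/existsP; exists t; rewrite inE tP tE /=; apply/andP; split.
    by have := cardsD1 b K; rewrite bK Kk => -[->].
  by apply/existsP; exists b; rewrite bt finset.setUC finset.setD1K ?eqxx.
apply/asboolP; rewrite residual_region_below -Kk.
by apply/residual_region_nonempty; exists B.
Qed.

Lemma triangulation_link_region I : (exists B, (I, B) \in P) ->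
  triangulation a (~: I)%SET (T I) (link_region a P I).
Proof.
have [tP _ _ _] := P_tiling.
move=> _; split=> [B|  |B B'].
- rewrite inE => /tP[dB cB iB]; split=> //.
  by rewrite -finset.disjoints_subset disjoint_sym.
- apply/seteqP; split=> x.
    by case=> B /=; rewrite inE => IB xB; apply/link_regionP; exists B.
  by move/link_regionP => [B IB xB]; exists B; rewrite //= inE.
- by rewrite !inE; exact: simplices_meet_in_face.
Qed.

Lemma card_label t : t \in P -> (#|t.1| <= n - d.+1)%N.
Proof.
have [tile_P _ _ _] := P_tiling => /tile_P[dt ct _].
have /eqP tU : #|t.1 :|: t.2|%SET == (#|t.1| + #|t.2|)%N.
  by rewrite (leq_card_setU t.1 t.2).2.
have := max_card (mem (t.1 :|: t.2)%SET); rewrite card_ord tU ct => tn.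
(* With d < n the truncated subtraction in the bound is exact. *)
have dn : (d < n)%N by apply: leq_trans tn; exact: leq_addl.
by rewrite leq_subRL // addnC.
Qed.

Lemma constructed_by_labels : constructed_by a T P.
Proof.
have tilesE k : proc_tiles a T k = level P k.
  by rewrite /proc_tiles /proc_index stateE new_tiles_labels.
split.
- move=> k I _; rewrite /proc_index /proc_region stateE /= => /labels_of_sizeP[Ik [B IB]].
  rewrite residual_region_below -Ik (residual_regionE IB).
  by apply: triangulation_link_region; exists B.
- by move=> k _; rewrite tilesE.
- rewrite /proc_index stateE /=; apply/eqP; rewrite -finset.subset0.
  apply/fintype.subsetP => I /labels_of_sizeP[Ik [B /card_label]].
  by rewrite /= Ik ltnn.
- apply/finset.setP => t; apply/idP/finset.bigcupP => [tP|[k _]]; last first.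
    by rewrite tilesE inE => /andP[].
  have tk : (#|t.1| < (n - d.+1).+1)%N by rewrite ltnS card_label.
  by exists (Ordinal tk) => //; rewrite tilesE inE tP eqxx.
- move=> k l _ _ kl; rewrite !tilesE -setI_eq0; apply/eqP/finset.setP => t.
  rewrite !inE; apply/negP => /andP[/andP[_ /eqP tk] /andP[_ /eqP tl]].
  by apply: kl; rewrite -tk.
Qed.

End PointConfiguration.

Theorem theorem2p10 (R : realType) (d n : nat) (a : 'I_n -> 'rV[R]_d)
    (P : {set {set 'I_n} * {set 'I_n}}) :
  (0 < d)%N -> affinely_spanning a -> fine_zonotopal_tiling a P ->
  exists T : {set 'I_n} -> {set {set 'I_n}},
    (forall I : {set 'I_n}, (exists B : {set 'I_n}, (I, B) \in P) ->
       triangulation a (~: I)%SET (T I) (link_region a P I)) /\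
    constructed_by a T P.
Proof.
move=> _ spa tilP; exists (label_triangulation P); split.
  exact: triangulation_link_region.
exact: constructed_by_labels.
Qed.
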